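(* Let $\mathbb F$ be a field of characteristic $3$. For any algebra $(\mathcal A,\mu)$ in $\mathsf{Rep}\,\mathsf C_3$, there is a natural homomorphism $\operatorname{Der}(\mathcal A,\mu)^{ss}\to\operatorname{Der}(\mathcal A^{ss},\mu^{ss})$ from the semisimplification of the Lie algebra of derivations of $(\mathcal A,\mu)$ into the Lie superalgebra of derivations of the superalgebra $(\mathcal A^{ss},\mu^{ss})$.
   Context: All vector spaces are finite-dimensional over $\mathbb F$; tensor products are over $\mathbb F$. Algebras are not assumed associative or unital. $\mathsf C_3$ is the cyclic group of order $3$ with a fixed generator $\sigma$; $\mathsf{Rep}\,\mathsf C_3$ is the symmetric tensor category of its finite-dimensional representations over $\mathbb F$ (usual tensor product and swap). An algebra $(\mathcal A,\mu)$ in $\mathsf{Rep}\,\mathsf C_3$ is an algebra on which $\sigma$ acts as an automorphism; then $\operatorname{Der}(\mathcal A,\mu)$ is a Lie algebra in $\mathsf{Rep}\,\mathsf C_3$ with $\sigma$ acting by $d\mapsto\sigma\circ d\circ\sigma^{-1}$. A morphism $f:X\to Y$ in $\mathsf{Rep}\,\mathsf C_3$ is negligible if $\operatorname{tr}(fg)=0$ for all morphisms $g:Y\to X$. $\mathsf{Ver}_3$ has the same objects and tensor product as $\mathsf{Rep}\,\mathsf C_3$, with morphisms the classes $[f]$ of morphisms of $\mathsf{Rep}\,\mathsf C_3$ modulo negligible ones, and braiding the class of the swap. Let $V_1=\mathbb Fv_0\oplus\mathbb Fv_1$ with $\sigma(v_0)=v_0+v_1$, $\sigma(v_1)=v_1$,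 and $\lambda:V_1\otimes V_1\to\mathbb F$, $v_0\otimes v_1\mapsto1$, $v_1\otimes v_0\mapsto-1$, $v_i\otimes v_i\mapsto0$. $\mathsf{sVec}$ is the category of vector superspaces with even linear maps and braiding $x\otimes y\mapsto(-1)^{|x||y|}y\otimes x$. There is a braided monoidal equivalence $F:\mathsf{sVec}\to\mathsf{Ver}_3$, $F(X)=X_{\bar0}\oplus(X_{\bar1}\otimes V_1)$ ($\sigma$ acting only on $V_1$), $F(f)=[f_{\bar0}\oplus(f_{\bar1}\otimes\mathrm{id}_{V_1})]$, with monoidal structure $J_{X,Y}:F(X)\otimes F(Y)\to F(X\otimes Y)$ the class of $x_{\bar0}\otimes y_{\bar0}\mapsto x_{\bar0}\otimes y_{\bar0}$, $x_{\bar0}\otimes(y_{\bar1}\otimes v)\mapsto(x_{\bar0}\otimes y_{\bar1})\otimes v$, $(x_{\bar1}\otimes v)\otimes y_{\bar0}\mapsto(x_{\bar1}\otimes y_{\bar0})\otimes v$, $(x_{\bar1}\otimes u)\otimes(y_{\bar1}\otimes v)\mapsto\lambda(u\otimes v)x_{\bar1}\otimes y_{\bar1}$. For an algebra $(\mathcal A,\mu)$ in $\mathsf{Rep}\,\mathsf C_3$, its semisimplification $(\mathcal A^{ss},\mu^{ss})$ is a superalgebra (an algebra in $\mathsf{sVec}$), unique up to isomorphism, such that $(F(\mathcal A^{ss}),F(\mu^{ss})\circ J_{\mathcal A^{ss},\mathcal A^{ss}})$ is isomorphic to $(\mathcal A,[\mu])$ as an algebra in $\mathsf{Ver}_3$;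 the semisimplification of a Lie algebra in $\mathsf{Rep}\,\mathsf C_3$ is a Lie superalgebra. $\operatorname{Der}(\mathcal A^{ss},\mu^{ss})$ is the Lie superalgebra spanned by the homogeneous linear maps $d$ of $\mathcal A^{ss}$ with $d(ab)=d(a)b+(-1)^{|d||a|}a\,d(b)$. *)

(* Defs.v *)
From HB Require Import structures.
From mathcomp Require Import all_boot all_order all_algebra.

Set Implicit Arguments.
Unset Strict Implicit.
Unset Printing Implicit Defensive.

Import GRing.Theory.
Local Open Scope ring_scope.

Definition ltrace (F : fieldType) (V : vectType F) (f : 'End(V)) : F :=
  \sum_(i < \dim {:V}) coord (vbasis {:V}) i (f (vbasis {:V})`_i).

(* U (x) V is modelled by its coordinates on the basis e_i (x) f_j, where e and
   f are the library's bases of U and V. *)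
Definition tens (F : fieldType) (U V : vectType F) : vectType F :=
  'M[F]_(\dim {:U}, \dim {:V}).

Definition tpure (F : fieldType) (U V : vectType F) (u : U) (v : V) :
    tens U V :=
  \matrix_(i, j) (coord (vbasis {:U}) i u * coord (vbasis {:V}) j v).

Definition tlift_fun (F : fieldType) (U V W : vectType F) (b : U -> V -> W)
    (m : tens U V) : W :=
  \sum_i \sum_j
    (m : 'M[F]_(_, _)) i j *: b (vbasis {:U})`_i (vbasis {:V})`_j.

(* The linear map u (x) v |-> b u v; it is meaningful for bilinear b only,
   see [tliftE]. *)
Definition tlift (F : fieldType) (U V W : vectType F) (b : U -> V -> W) :
    'Hom(tens U V, W) :=
  linfun (tlift_fun b).

Definition tmap (F : fieldType) (U V U' V' : vectType F)
    (f : 'Hom(U, U')) (g : 'Hom(V, V')) : 'Hom(tens U V, tens U' V') :=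
  tlift (fun u v => tpure (f u) (g v)).

Definition bilin (F : fieldType) (U V W : vectType F) (b : U -> V -> W) :
    Prop :=
  (forall u, linear (b u)) /\ (forall v, linear (b^~ v)).

Lemma tlift_fun_linear (F : fieldType) (U V W : vectType F)
    (b : U -> V -> W) : linear (tlift_fun b).
Proof.
move=> a m n; rewrite /tlift_fun scaler_sumr -big_split; apply: eq_bigr => i _.
rewrite scaler_sumr -big_split; apply: eq_bigr => j _ /=.
by rewrite !mxE scalerDl scalerA.
Qed.

HB.instance Definition _ (F : fieldType) (U V W : vectType F)
    (b : U -> V -> W) :=
  GRing.isLinear.Build F (tens U V) W _ (tlift_fun b) (tlift_fun_linear b).

Lemma tens_basis (F : fieldType) (U V : vectType F) (m : tens U V) :
  m = \sum_i \sum_j (m : 'M[F]_(_, _)) i j *: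
        tpure (vbasis {:U})`_i (vbasis {:V})`_j.
Proof.
rewrite {1}[m]matrix_sum_delta; apply: eq_bigr => i _.
apply: eq_bigr => j _; congr (_ *: _); apply/matrixP => k l; rewrite !mxE.
have bU := basis_free (vbasisP {:U}); have bV := basis_free (vbasisP {:V}).
by rewrite !coord_free // -natrM mulnb (eq_sym i) (eq_sym j).
Qed.

Lemma bilin_suml (F : fieldType) (U V W : vectType F) (b : U -> V -> W) v
    I r (P : pred I) (a : I -> F) (u : I -> U) : bilin b ->
  b (\sum_(i <- r | P i) a i *: u i) v = \sum_(i <- r | P i) a i *: b (u i) v.
Proof.
move=> [_ bl]; have b0 : b 0 v = 0.
  by have := bl v (-1) 0 0; rewrite scaler0 addr0 scaleN1r addNr.
elim/big_rec2: _ => [|i x y _ <-]; [exact: b0 | exact: bl].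
Qed.

Lemma bilin_sumr (F : fieldType) (U V W : vectType F) (b : U -> V -> W) u
    I r (P : pred I) (a : I -> F) (v : I -> V) : bilin b ->
  b u (\sum_(i <- r | P i) a i *: v i) = \sum_(i <- r | P i) a i *: b u (v i).
Proof.
move=> [br _]; have b0 : b u 0 = 0.
  by have := br u (-1) 0 0; rewrite scaler0 addr0 scaleN1r addNr.
elim/big_rec2: _ => [|i x y _ <-]; [exact: b0 | exact: br].
Qed.

Lemma tliftE (F : fieldType) (U V W : vectType F) (b : U -> V -> W) u v :
  bilin b -> tlift b (tpure u v) = b u v.
Proof.
move=> bb; rewrite /tlift lfunE /= /tlift_fun /tpure.
rewrite {2}(coord_vbasis (memvf u)) bilin_suml //; apply: eq_bigr => i _.
rewrite {2}(coord_vbasis (memvf v)) bilin_sumr // scaler_sumr.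
by apply: eq_bigr => j _; rewrite scalerA !mxE.
Qed.

Lemma tpure_bilin (F : fieldType) (U V : vectType F) : bilin (@tpure F U V).
Proof.
split=> [u|v] a x y; apply/matrixP => i j; rewrite !mxE linearP /=.
  by rewrite mulrDr mulrCA.
by rewrite mulrDl mulrA.
Qed.

Lemma bilin_lfun (F : fieldType) (U V U' V' W W' : vectType F)
    (h : 'Hom(W, W')) (b : U' -> V' -> W) (f : 'Hom(U, U')) (g : 'Hom(V, V')) :
  bilin b -> bilin (fun u v => h (b (f u) (g v))).
Proof.
by move=> [br bl]; split=> [u|v] a x y; rewrite linearP ?br ?bl linearP.
Qed.

Lemma tmapE (F : fieldType) (U V U' V' : vectType F)
    (f : 'Hom(U, U')) (g : 'Hom(V, V')) u v :
  tmap f g (tpure u v) = tpure (f u) (g v).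
Proof.
rewrite /tmap tliftE //.
have := bilin_lfun \1%VF f g (tpure_bilin U' V').
by case=> br bl; split=> [x|x] a y z; [have := br x a y z|have := bl x a y z];
   rewrite !id_lfunE.
Qed.

Lemma tens_ext (F : fieldType) (U V W : vectType F)
    (f g : 'Hom(tens U V, W)) :
  (forall u v, f (tpure u v) = g (tpure u v)) -> f = g.
Proof.
move=> fg; apply/lfunP => m; rewrite [m]tens_basis !linear_sum.
apply: eq_bigr => i _; rewrite !linear_sum; apply: eq_bigr => j _.
by rewrite !linearZ /= fg.
Qed.

Definition dmap (F : fieldType) (U V U' V' : vectType F)
    (f : 'Hom(U, U')) (g : 'Hom(V, V')) : 'Hom((U * V)%type, (U' * V')%type) :=
  linfun (fun x : U * V => (f x.1, g x.2)).

Definition dcase (F : fieldType) (U V W : vectType F)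
    (f : 'Hom(U, W)) (g : 'Hom(V, W)) : 'Hom((U * V)%type, W) :=
  linfun (fun x : U * V => f x.1 + g x.2).

Lemma linfunE (F : fieldType) (U V : vectType F) (f : U -> V) :
  linear f -> linfun f =1 f.
Proof.
move=> lin.
pose ff : {linear U -> V} := HB.pack f (GRing.isLinear.Build F U V _ f lin).
exact: (lfunE ff).
Qed.

Lemma dmapE (F : fieldType) (U V U' V' : vectType F)
    (f : 'Hom(U, U')) (g : 'Hom(V, V')) x : dmap f g x = (f x.1, g x.2).
Proof. by apply: linfunE => a y z; rewrite /= !linearP. Qed.

Lemma dcaseE (F : fieldType) (U V W : vectType F)
    (f : 'Hom(U, W)) (g : 'Hom(V, W)) x : dcase f g x = f x.1 + g x.2.
Proof.
by apply: linfunE => a y z; rewrite /= !linearP scalerDr addrACA.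
Qed.

(* A representation of C_3 is the action of the fixed generator sigma. *)
Record C3rep (F : fieldType) := MkC3rep {
  c3_sort :> vectType F;
  c3_act : 'End(c3_sort);
  c3_act3 : (c3_act \o c3_act \o c3_act = \1)%VF }.

Definition c3_mor (F : fieldType) (X Y : C3rep F) (f : 'Hom(X, Y)) : Prop :=
  (c3_act Y \o f = f \o c3_act X)%VF.

Lemma c3_act3E (F : fieldType) (X : C3rep F) x :
  c3_act X (c3_act X (c3_act X x)) = x.
Proof. by have /lfunP/(_ x) := c3_act3 X; rewrite !comp_lfunE id_lfunE. Qed.

Lemma c3_actK (F : fieldType) (X : C3rep F) :
  cancel (c3_act X) (c3_act X)^-1%VF.
Proof.
apply: lker0_lfunK; apply/lker0P => x y exy.
by rewrite -[x]c3_act3E exy c3_act3E.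
Qed.

Lemma c3_actVK (F : fieldType) (X : C3rep F) :
  cancel (c3_act X)^-1%VF (c3_act X).
Proof.
by move=> x; rewrite -[x in (_^-1)%VF x]c3_act3E c3_actK c3_act3E.
Qed.

Lemma c3_triv_act3 (F : fieldType) (V : vectType F) :
  (\1 \o \1 \o \1 = \1 :> 'End(V))%VF.
Proof. by rewrite !comp_lfun1l. Qed.

Definition c3_triv (F : fieldType) (V : vectType F) : C3rep F :=
  MkC3rep (c3_triv_act3 V).

Lemma c3_tens_act3 (F : fieldType) (X Y : C3rep F) :
  let s := tmap (c3_act X) (c3_act Y) in (s \o s \o s = \1)%VF.
Proof.
by move=> s; apply: tens_ext => x y; rewrite !comp_lfunE id_lfunE !tmapE !c3_act3E.
Qed.

Definition c3_tens (F : fieldType) (X Y : C3rep F) : C3rep F :=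
  MkC3rep (c3_tens_act3 X Y).

Lemma c3_sum_act3 (F : fieldType) (X Y : C3rep F) :
  let s := dmap (c3_act X) (c3_act Y) in (s \o s \o s = \1)%VF.
Proof.
by move=> s; apply/lfunP => -[x y]; rewrite !comp_lfunE id_lfunE !dmapE !c3_act3E.
Qed.

Definition c3_sum (F : fieldType) (X Y : C3rep F) : C3rep F :=
  MkC3rep (c3_sum_act3 X Y).

(* V_1 = F v_0 + F v_1, with v_0 = (1, 0) and v_1 = (0, 1); sigma is right
   multiplication by the matrix whose rows are sigma(v_0) and sigma(v_1). *)
Definition V1_act (F : fieldType) : 'End('rV[F]_2) :=
  linfun (mulmxr (\matrix_(i < 2, j < 2) (i <= j)%N%:R)).

Lemma V1_act3 (F : fieldType) (char3 : 3%N \in [pchar F]) :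
  (V1_act F \o V1_act F \o V1_act F = \1)%VF.
Proof.
apply/lfunP => x; rewrite !lfunE /= !lfunE /= !lfunE /=.
rewrite -!mulmxA -[RHS]mulmx1; congr (_ *m _).
have c3 : (1 + (1 + 1) : F) = 0 by have := pcharf0 char3; rewrite !mulrS mulr0n addr0.
apply/matrixP => i j; rewrite !mxE !big_ord_recl !big_ord0 !mxE.
rewrite !big_ord_recl !big_ord0 !mxE /=.
by case: i => -[|[|[]]] //= ?; case: j => -[|[|[]]] //= ?;
  rewrite ?mulr0 ?mul0r ?mulr1 ?mul1r ?addr0 ?add0r -?addrA ?c3.
Qed.

Definition V1 (F : fieldType) (char3 : 3%N \in [pchar F]) : C3rep F :=
  MkC3rep (V1_act3 char3).

Definition V1_form (F : fieldType) (u v : 'rV[F]_2) : F :=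
  u 0 0 * v 0 1 - u 0 1 * v 0 0.

(* Morphisms of Ver_3 are handled through representatives in Rep C_3. *)
Definition negligible (F : fieldType) (X Y : C3rep F) (f : 'Hom(X, Y)) : Prop :=
  forall g : 'Hom(Y, X), c3_mor g -> ltrace (f \o g) = 0.

Definition ver3_eq (F : fieldType) (X Y : C3rep F) (f g : 'Hom(X, Y)) : Prop :=
  negligible (f - g).

Definition ver3_iso (F : fieldType) (X Y : C3rep F) (f : 'Hom(X, Y)) : Prop :=
  c3_mor f /\
  exists g : 'Hom(Y, X),
    [/\ c3_mor g, @ver3_eq F X X (g \o f) \1 & @ver3_eq F Y Y (f \o g) \1].

Record C3alg (F : fieldType) := MkC3alg {
  c3a_rep :> C3rep F;
  c3a_mul : 'Hom(tens c3a_rep c3a_rep, c3a_rep);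
  c3a_mul_mor : @c3_mor F (c3_tens c3a_rep c3a_rep) c3a_rep c3a_mul }.

(* d |-> d(a b) - d(a) b - a d(b); see [derP] for the kernel. *)
Definition leibniz (F : fieldType) (A : C3alg F) (d : 'End(A)) :
    'Hom(tens A A, A) :=
  (d \o c3a_mul A)%VF - (c3a_mul A \o tmap d \1)%VF
  - (c3a_mul A \o tmap \1 d)%VF.

Definition der (F : fieldType) (A : C3alg F) : {vspace 'End(A)} :=
  lker (linfun (@leibniz F A)).

Lemma leibnizE (F : fieldType) (A : C3alg F) (d : 'End(A)) a b :
  leibniz d (tpure a b) =
  d (c3a_mul A (tpure a b)) - c3a_mul A (tpure (d a) b)
  - c3a_mul A (tpure a (d b)).
Proof.
by rewrite !(add_lfunE, opp_lfunE, comp_lfunE) !tmapE !id_lfunE.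
Qed.

Lemma leibniz_linear (F : fieldType) (A : C3alg F) : linear (@leibniz F A).
Proof.
move=> k d e; apply: tens_ext => a b.
have [tr tl] := tpure_bilin A A.
rewrite [RHS]add_lfunE scale_lfunE !leibnizE !add_lfunE !scale_lfunE tr tl.
rewrite !linearP /= !scalerDr [X in X + _]addrACA.
by rewrite [LHS]addrACA.
Qed.

HB.instance Definition _ (F : fieldType) (A : C3alg F) :=
  GRing.isLinear.Build F 'End(A) 'Hom(tens A A, A) _ (@leibniz F A)
    (@leibniz_linear F A).

Lemma derP (F : fieldType) (A : C3alg F) (d : 'End(A)) :
  reflect (forall a b, d (c3a_mul A (tpure a b)) =
             c3a_mul A (tpure (d a) b) + c3a_mul A (tpure a (d b)))
          (d \in der A).
Proof.
rewrite /der memv_ker lfunE /=; apply: (iffP eqP) => [d0 a b|dP].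
  have := congr1 (fun f : 'Hom(tens A A, A) => f (tpure a b)) d0.
  rewrite leibnizE lfunE /= => /eqP; rewrite -addrA -opprD subr_eq0.
  by move/eqP.
apply: tens_ext => a b; rewrite leibnizE dP lfunE /=.
by rewrite -addrA -opprD subrr.
Qed.

(* The projection vsproj only changes the type, by [der_act_mem]; the same holds
   for der_mul and sder_mul below, by [der_mul_mem] and [sbracket_mem]. *)
Definition der_act (F : fieldType) (A : C3alg F) : 'End(subvs_of (der A)) :=
  linfun (fun d : subvs_of (der A) =>
    vsproj (der A) (c3_act A \o vsval d \o (c3_act A)^-1)%VF).

Definition der_mul (F : fieldType) (A : C3alg F) :
    'Hom(tens (subvs_of (der A)) (subvs_of (der A)), subvs_of (der A)) :=
  tlift (fun d e : subvs_of (der A) =>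
    vsproj (der A) ((vsval d \o vsval e)%VF - (vsval e \o vsval d)%VF)).

Lemma c3a_mul_act (F : fieldType) (A : C3alg F) (a b : A) :
  c3_act A (c3a_mul A (tpure a b)) =
  c3a_mul A (tpure (c3_act A a) (c3_act A b)).
Proof.
have /lfunP/(_ (tpure a b)) := c3a_mul_mor A.
by rewrite !comp_lfunE /= tmapE.
Qed.

Lemma c3a_mul_actV (F : fieldType) (A : C3alg F) (a b : A) :
  (c3_act A)^-1%VF (c3a_mul A (tpure a b)) =
  c3a_mul A (tpure ((c3_act A)^-1%VF a) ((c3_act A)^-1%VF b)).
Proof.
by apply: (can_inj (@c3_actK F A)); rewrite c3a_mul_act !c3_actVK.
Qed.

Lemma der_act_mem (F : fieldType) (A : C3alg F) (d : 'End(A)) :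
  d \in der A -> (c3_act A \o d \o (c3_act A)^-1)%VF \in der A.
Proof.
move=> /derP dP; apply/derP => a b.
rewrite !comp_lfunE c3a_mul_actV dP linearD /= !c3a_mul_act.
by rewrite !c3_actVK.
Qed.

Lemma der_mul_mem (F : fieldType) (A : C3alg F) (d e : 'End(A)) :
  d \in der A -> e \in der A -> (d \o e)%VF - (e \o d)%VF \in der A.
Proof.
move=> /derP dP /derP eP; apply/derP => a b.
have [tr tl] := tpure_bilin A A.
have sr (u x y : A) : tpure u (x - y) = tpure u x - tpure u y.
  by have := tr u (-1) y x; rewrite !scaleN1r ![- _ + _]addrC.
have sl (u x y : A) : tpure (x - y) u = tpure x u - tpure y u.
  by have := tl u (-1) y x; rewrite !scaleN1r ![- _ + _]addrC.
rewrite !(add_lfunE, opp_lfunE, comp_lfunE) dP eP sr sl.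
rewrite !linearD /= !linearN /= !dP !eP.
set x1 := c3a_mul A _; set x2 := c3a_mul A _; set x3 := c3a_mul A _.
set x4 := c3a_mul A _; set x5 := c3a_mul A _; set x6 := c3a_mul A _.
rewrite -opprD [x5 + x3 + _]addrACA opprD addrACA [x5 + x2]addrC [x3 + x4]addrC.
by rewrite !addrKA.
Qed.

Lemma der_actE (F : fieldType) (A : C3alg F) (d : subvs_of (der A)) :
  vsval (der_act A d) = (c3_act A \o vsval d \o (c3_act A)^-1)%VF.
Proof.
rewrite /der_act linfunE ?vsprojK ?der_act_mem ?subvsP // => k x y.
by rewrite -linearP; congr (vsproj _ _); rewrite linearP /= comp_lfunDr
  comp_lfunDl -comp_lfunZr -comp_lfunZl.
Qed.

Lemma der_mulE (F : fieldType) (A : C3alg F) (d e : subvs_of (der A)) :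
  vsval (der_mul A (tpure d e)) =
  (vsval d \o vsval e)%VF - (vsval e \o vsval d)%VF.
Proof.
rewrite /der_mul tliftE ?vsprojK ?der_mul_mem ?subvsP //.
split=> u k x y; rewrite -linearP; congr (vsproj _ _);
  rewrite linearP /= comp_lfunDr comp_lfunDl -comp_lfunZr -comp_lfunZl
   scalerBr; by rewrite opprD addrACA.
Qed.

Lemma der_act3 (F : fieldType) (A : C3alg F) :
  (der_act A \o der_act A \o der_act A = \1)%VF.
Proof.
apply/lfunP => d; apply: val_inj; apply/lfunP => a.
rewrite !comp_lfunE id_lfunE /= !der_actE !comp_lfunE c3_act3E.
congr (vsval d _); rewrite -[RHS]c3_act3E.
by rewrite -{1}[a]c3_act3E !c3_actK c3_act3E.
Qed.

Definition der_rep (F : fieldType) (A : C3alg F) : C3rep F :=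
  MkC3rep (der_act3 A).

Lemma der_mul_mor (F : fieldType) (A : C3alg F) :
  @c3_mor F (c3_tens (der_rep A) (der_rep A)) (der_rep A) (der_mul A).
Proof.
apply: tens_ext => d e; apply: val_inj; apply/lfunP => a.
rewrite !comp_lfunE /= der_actE tmapE !der_mulE /= !der_actE.
by rewrite !(add_lfunE, opp_lfunE, comp_lfunE) /= !c3_actK linearB.
Qed.

Definition Der (F : fieldType) (A : C3alg F) : C3alg F :=
  MkC3alg (der_mul_mor A).

Definition der_ev (F : fieldType) (A : C3alg F) : 'Hom(tens (Der A) A, A) :=
  tlift (fun (d : subvs_of (der A)) (a : A) => vsval d a).

Record svec (F : fieldType) := MkSvec {
  sev : vectType F;
  sod : vectType F }.

Definition smor (F : fieldType) (X Y : svec F) : Type :=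
  'Hom(sev X, sev Y) * 'Hom(sod X, sod Y).

Definition sid (F : fieldType) (X : svec F) : smor X X := (\1%VF, \1%VF).

Definition scomp (F : fieldType) (X Y Z : svec F) (f : smor Y Z)
    (g : smor X Y) : smor X Z :=
  ((f.1 \o g.1)%VF, (f.2 \o g.2)%VF).

Definition stens (F : fieldType) (X Y : svec F) : svec F :=
  MkSvec (tens (sev X) (sev Y) * tens (sod X) (sod Y))%type
         (tens (sev X) (sod Y) * tens (sod X) (sev Y))%type.

Definition stmap (F : fieldType) (X Y X' Y' : svec F) (f : smor X X')
    (g : smor Y Y') : smor (stens X Y) (stens X' Y') :=
  (dmap (tmap f.1 g.1) (tmap f.2 g.2), dmap (tmap f.1 g.2) (tmap f.2 g.1)).

Record salg (F : fieldType) := MkSalg {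
  sa_vec :> svec F;
  sa_mul : smor (stens sa_vec sa_vec) sa_vec }.

Definition salg_hom (F : fieldType) (S T : salg F) (f : smor S T) : Prop :=
  scomp f (sa_mul S) = scomp (sa_mul T) (stmap f f).

Definition stot (F : fieldType) (X : svec F) : vectType F :=
  (sev X * sod X)%type.

Definition shom (F : fieldType) (X : svec F) (p : bool) : {vspace stot X} :=
  if p then lker (linfun (fst : stot X -> sev X))
  else lker (linfun (snd : stot X -> sod X)).

Definition sproj (F : fieldType) (X : svec F) (p : bool) : 'End(stot X) :=
  if p then linfun (fun x : stot X => (0, x.2) : stot X)
  else linfun (fun x : stot X => (x.1, 0) : stot X).

Definition smul (F : fieldType) (S : salg F) (a b : stot S) : stot S :=
  ((sa_mul S).1 (tpure a.1 b.1, tpure a.2 b.2),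
   (sa_mul S).2 (tpure a.1 b.2, tpure a.2 b.1)).

(* a |-> (-1)^(p |a|) a *)
Definition ssign (F : fieldType) (X : svec F) (p : bool) : 'End(stot X) :=
  linfun (fun x : stot X => (x.1, (-1) ^+ p *: x.2) : stot X).

Definition sder_deg (F : fieldType) (S : salg F) (p i : bool)
    (d : 'End(stot S)) : 'End(stot S) :=
  (sproj S (~~ (i (+) p)) \o d \o sproj S i)%VF.

Definition sder_leibniz (F : fieldType) (S : salg F) (p : bool)
    (d : 'End(stot S)) : 'Hom(tens (stot S) (stot S), stot S) :=
  let m := tlift (@smul F S) in
  (d \o m)%VF - (m \o tmap d \1)%VF - (m \o tmap (ssign S p) d)%VF.

(* The superderivations of parity p, see [sderP]. *)
Definition sder (F : fieldType) (S : salg F) (p : bool) :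
    {vspace 'End(stot S)} :=
  (lker (linfun (@sder_deg F S p false)) :&:
   lker (linfun (@sder_deg F S p true)) :&:
   lker (linfun (@sder_leibniz F S p)))%VS.

Lemma smul_bilin (F : fieldType) (S : salg F) : bilin (@smul F S).
Proof.
split=> u k x y; rewrite /smul /=.
  have [t1 _] := tpure_bilin (sev S) (sev S).
  have [t2 _] := tpure_bilin (sod S) (sod S).
  have [t3 _] := tpure_bilin (sev S) (sod S).
  have [t4 _] := tpure_bilin (sod S) (sev S).
  by rewrite t1 t2 t3 t4; congr pair; exact: (linearP _ k (_, _) (_, _)).
have [_ t1] := tpure_bilin (sev S) (sev S).
have [_ t2] := tpure_bilin (sod S) (sod S).
have [_ t3] := tpure_bilin (sev S) (sod S).
have [_ t4] := tpure_bilin (sod S) (sev S).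
by rewrite t1 t2 t3 t4; congr pair; exact: (linearP _ k (_, _) (_, _)).
Qed.

Lemma sprojE (F : fieldType) (X : svec F) p x :
  sproj X p x = if p then (0, x.2) else (x.1, 0).
Proof.
by case: p; rewrite /sproj linfunE // => k y z; congr pair;
   rewrite /= ?scaler0 ?addr0.
Qed.

Lemma ssignE (F : fieldType) (X : svec F) p x :
  ssign X p x = (x.1, (-1) ^+ p *: x.2).
Proof.
rewrite /ssign linfunE // => k y z; congr pair.
by rewrite /= scalerDr !scalerA mulrC.
Qed.

Lemma mem_shom (F : fieldType) (X : svec F) p (x : stot X) :
  (x \in shom X p) = if p then x.1 == 0 else x.2 == 0.
Proof. by case: p; rewrite /shom memv_ker lfunE. Qed.

Lemma sproj_shom (F : fieldType) (X : svec F) p (x : stot X) :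
  sproj X p x \in shom X p.
Proof. by rewrite sprojE mem_shom; case: p => /=. Qed.

Lemma sproj_id (F : fieldType) (X : svec F) p (x : stot X) :
  x \in shom X p -> sproj X p x = x.
Proof.
by rewrite sprojE mem_shom; case: x p => x0 x1 [] /= /eqP ->.
Qed.

Lemma sproj_eq0 (F : fieldType) (X : svec F) p (x : stot X) :
  (sproj X (~~ p) x == 0) = (x \in shom X p).
Proof.
rewrite sprojE mem_shom; case: x p => x0 x1 [] /=.
  by rewrite xpair_eqE eqxx andbT.
by rewrite xpair_eqE eqxx.
Qed.

Lemma sproj_sum (F : fieldType) (X : svec F) (x : stot X) :
  x = sproj X false x + sproj X true x.
Proof. by rewrite !sprojE; case: x => a b; congr pair; rewrite ?addr0 ?add0r. Qed.

Lemma ssign_shom (F : fieldType) (X : svec F) p i (x : stot X) :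
  x \in shom X i -> ssign X p x = (-1) ^+ (p && i) *: x.
Proof.
rewrite ssignE mem_shom; case: x i => x0 x1 [] /= /eqP ->;
  rewrite ?andbT ?andbF ?scale1r ?scaler0 //.
by congr pair; rewrite /= scaler0.
Qed.

Lemma sder_degE (F : fieldType) (S : salg F) p i (d : 'End(stot S)) x :
  sder_deg p i d x = sproj S (~~ (i (+) p)) (d (sproj S i x)).
Proof. by rewrite !comp_lfunE. Qed.

Lemma sder_leibnizE (F : fieldType) (S : salg F) p (d : 'End(stot S)) a b :
  sder_leibniz p d (tpure a b) =
  d (smul a b) - smul (d a) b - smul (ssign S p a) (d b).
Proof.
rewrite /sder_leibniz !(add_lfunE, opp_lfunE, comp_lfunE) !tmapE !id_lfunE.
by rewrite !tliftE //; apply: smul_bilin.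
Qed.

Lemma sder_deg_linear (F : fieldType) (S : salg F) p i :
  linear (@sder_deg F S p i).
Proof.
move=> k d e; apply/lfunP => x.
by rewrite [RHS]add_lfunE scale_lfunE !sder_degE add_lfunE scale_lfunE linearP.
Qed.

Lemma sder_leibniz_linear (F : fieldType) (S : salg F) p :
  linear (@sder_leibniz F S p).
Proof.
move=> k d e; apply: tens_ext => a b; have [mr ml] := smul_bilin S.
rewrite [RHS]add_lfunE scale_lfunE !sder_leibnizE !add_lfunE !scale_lfunE mr ml.
rewrite !opprD -!scalerN.
rewrite !scalerDr [X in X + _]addrACA.
by rewrite [LHS]addrACA.
Qed.

Lemma sderP (F : fieldType) (S : salg F) p (d : 'End(stot S)) :
  reflect
    ((forall i, (d @: shom S i <= shom S (i (+) p))%VS) /\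
     (forall i a b, a \in shom S i ->
        d (smul a b) = smul (d a) b + (-1) ^+ (p && i) *: smul a (d b)))
    (d \in sder S p).
Proof.
have [mr ml] := smul_bilin S.
have mZ k (a b : stot S) : smul (k *: a) b = k *: smul a b.
  have m0 : smul 0 b = 0.
    by have := ml b (-1) 0 0; rewrite /= scaler0 addr0 scaleN1r addNr.
  by have := ml b k a 0; rewrite /= m0 !addr0.
have mD (a a' b : stot S) : smul (a + a') b = smul a b + smul a' b.
  by have := ml b 1 a a'; rewrite /= !scale1r.
rewrite /sder !memv_cap !memv_ker !linfunE; try exact: sder_deg_linear;
  try exact: sder_leibniz_linear.
have degP i : reflect (d @: shom S i <= shom S (i (+) p))%VS
                (sder_deg p i d == 0).
  apply: (iffP eqP) => [d0|/subvP dS].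
    apply/subvP => _ /memv_imgP [x xi ->].
    rewrite -sproj_eq0 -[x](sproj_id xi) -sder_degE d0 zero_lfunE //.
  apply/lfunP => x; rewrite sder_degE zero_lfunE; apply/eqP.
  by rewrite sproj_eq0 dS // memv_img // sproj_shom.
apply: (iffP andP) => [[/andP [/degP d0 /degP d1] /eqP dL]|[dS dL]].
  split=> [[]//|i a b ai].
  have /lfunP/(_ (tpure a b)) := dL.
  rewrite sder_leibnizE zero_lfunE (ssign_shom _ ai) mZ => /eqP.
  by rewrite -addrA -opprD subr_eq0 => /eqP.
split; first by apply/andP; split; apply/degP.
apply/eqP; apply: tens_ext => a b; rewrite sder_leibnizE zero_lfunE.
rewrite (sproj_sum a).
move: (sproj_shom false a) (sproj_shom true a).
move: (sproj S false a) (sproj S true a) => a0 a1 h0 h1.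
rewrite mD !linearD /= !mD (dL _ _ _ h0) (dL _ _ _ h1).
rewrite (ssign_shom _ h0) (ssign_shom _ h1) !mZ.
by rewrite [X in X - _ - _ = _]addrACA [X in X - _ = _]addrC addKr subrr.
Qed.

Definition sbracket (F : fieldType) (X : svec F) (p q : bool)
    (d e : 'End(stot X)) : 'End(stot X) :=
  (d \o e)%VF - (-1) ^+ (p && q) *: (e \o d)%VF.

Lemma zmod_bracket (V : zmodType) (x1 x2 x3 x4 x5 x6 : V) :
  x1 + x2 + (x3 + x4) - (x5 + x3 + (x2 + x6)) = x1 - x5 + (x4 - x6).
Proof.
rewrite [x5 + x3 + _]addrACA opprD addrACA [x5 + x2]addrC [x3 + x4]addrC.
by rewrite !addrKA.
Qed.

Lemma sbracket_mem (F : fieldType) (S : salg F) p q (d e : 'End(stot S)) :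
  d \in sder S p -> e \in sder S q ->
  sbracket p q d e \in sder S (p (+) q).
Proof.
move=> /sderP [dS dL] /sderP [eS eL].
have dS' i x : x \in shom S i -> d x \in shom S (i (+) p).
  by move=> xi; apply: (subvP (dS i)); apply: memv_img.
have eS' i x : x \in shom S i -> e x \in shom S (i (+) q).
  by move=> xi; apply: (subvP (eS i)); apply: memv_img.
have [mr ml] := smul_bilin S.
have mrD k (a b c : stot S) : smul a (b + k *: c) = smul a b + k *: smul a c.
  by rewrite addrC mr addrC.
have mlD k (a b c : stot S) : smul (b + k *: c) a = smul b a + k *: smul c a.
  by rewrite addrC ml addrC.
apply/sderP; split=> [i|i a b ai].
  apply/subvP => _ /memv_imgP [x xi ->].
  rewrite /sbracket add_lfunE opp_lfunE scale_lfunE !comp_lfunE.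
  rewrite memvB ?memvZ //.
    by rewrite addbA addbAC; apply: dS'; apply: eS'.
  by rewrite addbA; apply: eS'; apply: dS'.
rewrite /sbracket !(add_lfunE, opp_lfunE, scale_lfunE, comp_lfunE).
rewrite -!scaleNr mlD mrD (eL _ _ _ ai) (dL _ _ _ ai) !linearD /= !linearZ /=.
rewrite (dL _ _ _ ai) (eL _ _ _ ai) (dL _ _ _ (eS' _ _ ai)).
rewrite (eL _ _ _ (dS' _ _ ai)).
rewrite !scalerDr !scalerA !scaleNr.
set x1 := smul (d _) b; set x2 := smul (e a) _; set x3 := smul (d a) _.
set x4 := smul a _; set x5 := smul (e _) b; set x6 := smul a _.
move: (zmod_bracket x1 ((-1) ^+ (p && (i (+) q)) *: x2)
  ((-1) ^+ (q && i) *: x3) (((-1) ^+ (q && i) * (-1) ^+ (p && i)) *: x4)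
  ((-1) ^+ (p && q) *: x5)
  (((-1) ^+ (p && q) * ((-1) ^+ (p && i) * (-1) ^+ (q && i))) *: x6)).
clearbody x1 x2 x3 x4 x5 x6; clear.
by case: p q i => [] [] [] /=; rewrite ?(expr1, expr0, mulN1r, mulrN1, mulr1,
  mul1r, opprK, scale1r, scaleN1r, scaleNr, opprD, mulNr, mulrN).
Qed.

Definition sder_mul (F : fieldType) (S : salg F) (p q r : bool) :
    'Hom(tens (subvs_of (sder S p)) (subvs_of (sder S q)),
         subvs_of (sder S r)) :=
  tlift (fun (d : subvs_of (sder S p)) (e : subvs_of (sder S q)) =>
    vsproj (sder S r) (sbracket p q (vsval d) (vsval e))).

Lemma sder_mulE (F : fieldType) (S : salg F) (p q : bool)
    (d : subvs_of (sder S p)) (e : subvs_of (sder S q)) :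
  vsval (sder_mul S p q (p (+) q) (tpure d e)) =
  sbracket p q (vsval d) (vsval e).
Proof.
rewrite /sder_mul tliftE ?vsprojK ?sbracket_mem ?subvsP // /sbracket.
split=> u k x y; rewrite -linearP; congr (vsproj _ _);
  rewrite linearP /= comp_lfunDr comp_lfunDl -comp_lfunZr -comp_lfunZl;
  rewrite scalerBr !scalerDr !scalerA mulrC opprD addrACA //.
Qed.

Definition sDer_vec (F : fieldType) (S : salg F) : svec F :=
  MkSvec (subvs_of (sder S false)) (subvs_of (sder S true)).

Definition sDer (F : fieldType) (S : salg F) : salg F :=
  @MkSalg F (sDer_vec S)
    (dcase (sder_mul S false false false) (sder_mul S true true false),
     dcase (sder_mul S false true true) (sder_mul S true false true)).

(* d (x) a |-> d(a), by components *)
Definition sder_ev (F : fieldType) (S : salg F) : smor (stens (sDer S) S) S :=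
  (dcase
     (tlift (fun (d : subvs_of (sder S false)) (a : sev S) =>
        (vsval d (a, 0)).1))
     (tlift (fun (d : subvs_of (sder S true)) (a : sod S) =>
        (vsval d (0, a)).1)),
   dcase
     (tlift (fun (d : subvs_of (sder S false)) (a : sod S) =>
        (vsval d (0, a)).2))
     (tlift (fun (d : subvs_of (sder S true)) (a : sev S) =>
        (vsval d (a, 0)).2))).

Definition Ver (F : fieldType) (char3 : 3%N \in [pchar F]) (X : svec F) :
    C3rep F :=
  c3_sum (c3_triv (sev X)) (c3_tens (c3_triv (sod X)) (V1 char3)).

Definition Ver_map (F : fieldType) (char3 : 3%N \in [pchar F]) (X Y : svec F)
    (f : smor X Y) : 'Hom(Ver char3 X, Ver char3 Y) :=
  dmap f.1 (tmap f.2 (\1%VF : 'End('rV[F]_2))).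

(* x.2 and y.2 are tensors, so each is decomposed by a tlift of its own; see
   [Ver_JE] for the value on pure tensors. *)
Definition Ver_J_fun (F : fieldType) (X Y : svec F)
    (x : sev X * tens (sod X) 'rV[F]_2) (y : sev Y * tens (sod Y) 'rV[F]_2) :
    sev (stens X Y) * tens (sod (stens X Y)) 'rV[F]_2 :=
  ((tpure x.1 y.1,
    tlift (fun (x1 : sod X) (u : 'rV[F]_2) =>
      tlift (fun (y1 : sod Y) (v : 'rV[F]_2) =>
        V1_form u v *: tpure x1 y1) y.2) x.2),
   tlift (fun (y1 : sod Y) (v : 'rV[F]_2) =>
     tpure ((tpure x.1 y1, 0) : sod (stens X Y)) v) y.2 +
   tlift (fun (x1 : sod X) (u : 'rV[F]_2) =>
     tpure ((0, tpure x1 y.1) : sod (stens X Y)) u) x.2).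

Definition Ver_J (F : fieldType) (char3 : 3%N \in [pchar F]) (X Y : svec F) :
    'Hom(tens (Ver char3 X) (Ver char3 Y), Ver char3 (stens X Y)) :=
  tlift (@Ver_J_fun F X Y).

Lemma tlift_linear (F : fieldType) (T U V W : vectType F)
    (b : T -> U -> V -> W) m :
  (forall u v, linear (fun t => b t u v)) -> linear (fun t => tlift (b t) m).
Proof.
move=> bl k x y; rewrite !lfunE /= /tlift_fun scaler_sumr -big_split.
apply: eq_bigr => i _; rewrite scaler_sumr -big_split; apply: eq_bigr => j _ /=.
by rewrite bl scalerDr !scalerA mulrC.
Qed.

Lemma V1_form_bilin (F : fieldType) (k : F) (u v w : 'rV[F]_2) :
  (V1_form (k *: u + v) w = k * V1_form u w + V1_form v w) *
  (V1_form w (k *: u + v) = k * V1_form w u + V1_form w v).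
Proof.
rewrite /V1_form !mxE; split; rewrite mulrBr.
  by rewrite !mulrDl opprD addrACA !mulrA.
by rewrite !mulrDr opprD addrACA !mulrA ![_ * k]mulrC.
Qed.

Lemma Ver_J_bilin (F : fieldType) (X Y : svec F) : bilin (@Ver_J_fun F X Y).
Proof.
have tb (U V : vectType F) : bilin (@tpure F U V) := tpure_bilin U V.
have pl (U V : vectType F) v : linear ((@tpure F U V)^~ v) := (tb U V).2 v.
have pr (U V : vectType F) u : linear (@tpure F U V u) := (tb U V).1 u.
split=> [x|y] k a b; rewrite /Ver_J_fun /=.
  congr (_, _); first congr (_, _).
  - exact: pr.
  - apply: (@tlift_linear _ (tens (sod Y) 'rV[F]_2) _ _ _
      (fun t x1 u => tlift (fun y1 v => V1_form u v *: tpure x1 y1) t)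
      _ _ k a.2 b.2) => x1 u; exact: linearP.
  - rewrite /= scalerDr addrACA linearP; congr (_ + _).
    apply: (@tlift_linear _ (sev Y) _ _ _
      (fun t x1 u => tpure ((0, tpure x1 t) : sod (stens X Y)) u)
      _ _ k a.1 b.1) => x1 u k' c d.
    rewrite -pl; congr (tpure _ _); congr (_, _); last exact: pr.
    by rewrite /= scaler0 addr0.
congr (_, _); first congr (_, _).
- exact: pl.
- exact: linearP.
- rewrite /= scalerDr addrACA linearP; congr (_ + _).
  apply: (@tlift_linear _ (sev X) _ _ _
    (fun t y1 v => tpure ((tpure t y1, 0) : sod (stens X Y)) v)
    _ _ k a.1 b.1) => y1 v k' c d.
  rewrite -pl; congr (tpure _ _); congr (_, _); first exact: pl.
  by rewrite /= scaler0 addr0.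
Qed.

Lemma Ver_JE (F : fieldType) (char3 : 3%N \in [pchar F]) (X Y : svec F)
    (x0 : sev X) (x1 : sod X) (y0 : sev Y) (y1 : sod Y) (u v : 'rV[F]_2) :
  Ver_J char3 X Y (tpure ((x0, tpure x1 u) : Ver char3 X)
                         ((y0, tpure y1 v) : Ver char3 Y)) =
  ((tpure x0 y0, V1_form u v *: tpure x1 y1),
   tpure ((tpure x0 y1, 0) : sod (stens X Y)) v +
   tpure ((0, tpure x1 y0) : sod (stens X Y)) u).
Proof.
have pl (U V : vectType F) w : linear ((@tpure F U V)^~ w) :=
  (tpure_bilin U V).2 w.
have pr (U V : vectType F) w : linear (@tpure F U V w) :=
  (tpure_bilin U V).1 w.
have b1 x w : bilin (fun (y : sod Y) (z : 'rV[F]_2) =>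
    V1_form w z *: (tpure x y : tens (sod X) (sod Y))).
  split=> [y|z] k c d /=; first by rewrite V1_form_bilin scalerDl scalerA.
  by rewrite pr scalerDr !scalerA mulrC.
rewrite /Ver_J tliftE; last exact: Ver_J_bilin.
rewrite /Ver_J_fun /= !tliftE //.
- split=> [y|z] k c d /=; first exact: pr.
  rewrite -pl; congr (tpure _ _); congr (_, _); last exact: pl.
  by rewrite /= scaler0 addr0.
- split=> [y|z] k c d /=; first exact: pr.
  rewrite -pl; congr (tpure _ _); congr (_, _); first exact: pr.
  by rewrite /= scaler0 addr0.
- split=> [y|z] k c d /=.
    apply: (@tlift_linear _ 'rV[F]_2 _ _ _
      (fun t y1 v => V1_form t v *: tpure y y1)) => y' v' k' c' d' /=.
    by rewrite V1_form_bilin scalerDl scalerA.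
  apply: (@tlift_linear _ (sod X) _ _ _
    (fun t y1 v => V1_form z v *: tpure t y1)) => y' v' k' c' d' /=.
  by rewrite pl scalerDr !scalerA mulrC.
Qed.

(* phi represents an isomorphism of algebras in Ver_3 from
   (F(S), F(mu_S) o J) to (A, [mu]); thus (S, phi) is a semisimplification
   of A. *)
Definition semisimplification (F : fieldType) (char3 : 3%N \in [pchar F])
    (A : C3alg F) (S : salg F) (phi : 'Hom(Ver char3 S, A)) : Prop :=
  ver3_iso phi /\
  @ver3_eq F (c3_tens (Ver char3 S) (Ver char3 S)) A
    (phi \o (Ver_map char3 (sa_mul S) \o Ver_J char3 S S))%VF
    (c3a_mul A \o tmap phi phi)%VF.

(* Phi : L -> Der(S) turns S into a module over L. It is the semisimplification
   of the action of Der(A) on A when, along the identifications psi of F(L) with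
   Der(A) and phi of F(S) with A, the resulting action L (x) S -> S corresponds
   to the class of the evaluation map Der(A) (x) A -> A. *)
Definition induced_by_action (F : fieldType) (char3 : 3%N \in [pchar F])
    (A : C3alg F) (S L : salg F) (phi : 'Hom(Ver char3 S, A))
    (psi : 'Hom(Ver char3 L, Der A)) (Phi : smor L (sDer S)) : Prop :=
  @ver3_eq F (c3_tens (Ver char3 L) (Ver char3 S)) A
    (phi \o (Ver_map char3 (scomp (sder_ev S) (stmap Phi (sid S)))
               \o Ver_J char3 L S))%VF
    (der_ev A \o tmap psi phi)%VF.

(* Main.v *)
From HB Require Import structures.
Require Import Defs.
From mathcomp Require Import all_boot all_order all_algebra.
From mathcomp Require Import ring.

Set Implicit Arguments.
Unset Strict Implicit.
Unset Printing Implicit Defensive.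

Import GRing.Theory.
Local Open Scope ring_scope.

(** A homogeneous element of a superspace X is tested in Ver_3 through a
   morphism from 1 (even case) or V_1 (odd case) to F(X).  The identities
   d(ab) = d(a) b + a d(b) and [d, e](a) = d(e a) - e(d a), which hold in
   Rep C_3 for d, e in Der(A), then become super identities for the elements of
   the semisimplifications, because negligible morphisms form a tensor ideal and
   because the structure maps 1, lambda of F are associative and supercommutative
   up to negligible morphisms.  The only non-strict instance of the latter is
   lambda(y, z) x + lambda(x, z) y = 0 on V_1^3: the left-hand side factors
   through the free module S^2 V_1, hence is a transfer, and a transfer composed
   with a morphism has trace 3 tr(..) = 0.  The induced map is unique because F
   is faithful and its monoidal structure is invertible. *)

(** Elements of A do not exist in Ver_3, so every term of an identity in three arguments becomes a
    morphism on a triple tensor power, and two terms can be compared only once their arguments stand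
    in the same order and bracketing. This is where the signs arise: (-1)^(ij) is the price of
    moving an argument of parity i past one of parity j. The two test objects are kept in the single
    object 1 (+) V_1, with parities as Boolean indices, so that the eight parity cases share one
    statement. S^2 V_1 is free because the squares of v_0, v_0 + v_1 and v_0 - v_1 form a basis that
    sigma permutes cyclically; the coordinate dual to the square of v_0 yields the maps whose
    transfers are taken below. The splitting of V_1 (x) V_1 into 1 and S^2 V_1 also makes lambda
    invertible in Ver_3. This inverse serves twice: it cancels J when two elements are compared, and
    it produces the operators on the semisimplification from the action of Der(A) on A. *)

Lemma linear_fun0 (F : fieldType) (U V : vectType F) (f : U -> V) :
  linear f -> f 0 = 0.
Proof. by move=> /(_ (-1) 0 0); rewrite scaler0 addr0 scaleN1r addNr. Qed.

(** * Bilinearity of pure tensors *)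

Section Tpure.
Variables (F : fieldType) (U V : vectType F).

Lemma tpure_linear_l (v : V) : linear (fun u : U => tpure u v).
Proof. by case: (tpure_bilin U V). Qed.

Lemma tpure_linear_r (u : U) : linear (@tpure F U V u).
Proof. by case: (tpure_bilin U V). Qed.

Lemma tpure0l (v : V) : tpure (0 : U) v = 0.
Proof. exact: linear_fun0 (tpure_linear_l v). Qed.

Lemma tpure0r (u : U) : tpure u (0 : V) = 0.
Proof. exact: linear_fun0 (tpure_linear_r u). Qed.

Lemma tpureZl k (u : U) (v : V) : tpure (k *: u) v = k *: tpure u v.
Proof. by have := tpure_linear_l v k u 0; rewrite /= tpure0l !addr0. Qed.

Lemma tpureZr k (u : U) (v : V) : tpure u (k *: v) = k *: tpure u v.
Proof. by have := tpure_linear_r u k v 0; rewrite tpure0r !addr0. Qed.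

Lemma tpureDr (u : U) (v w : V) : tpure u (v + w) = tpure u v + tpure u w.
Proof. by have := tpure_linear_r u 1 v w; rewrite !scale1r. Qed.

Lemma tpure_sumr (u : U) I r (P : pred I) (v : I -> V) :
  tpure u (\sum_(i <- r | P i) v i) = \sum_(i <- r | P i) tpure u (v i).
Proof. by elim/big_rec2: _ => [|i x y _ <-]; rewrite ?tpure0r ?tpureDr. Qed.

Lemma tpureDl (u w : U) (v : V) : tpure (u + w) v = tpure u v + tpure w v.
Proof. by have := tpure_linear_l v 1 u w; rewrite !scale1r. Qed.

Lemma tpure_suml (v : V) I r (P : pred I) (u : I -> U) :
  tpure (\sum_(i <- r | P i) u i) v = \sum_(i <- r | P i) tpure (u i) v.
Proof. by elim/big_rec2: _ => [|i x y _ <-]; rewrite ?tpure0l ?tpureDl. Qed.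
End Tpure.

(** * Traces of endomorphisms *)

Lemma scalar_sum (F : fieldType) (V : vectType F) (f : V -> F) I r (P : pred I)
    (a : I -> F) (v : I -> V) : linear (f : V -> F^o) ->
  f (\sum_(i <- r | P i) a i *: v i) = \sum_(i <- r | P i) a i * f (v i).
Proof.
move=> lin.
pose ff : {linear V -> F^o} := HB.pack f (GRing.isLinear.Build F V F^o _ f lin).
rewrite -[f]/(ff : V -> F) linear_sum; apply: eq_bigr => i _.
by rewrite linearZ.
Qed.

(** The frame writes f as the sum of the rank-one maps x |-> c_i(x) f(e_i), each of trace
    c_i(f(e_i)). This form serves both the product frame of a tensor product and the explicit frame
    of 1 (+) V_1. *)
Lemma ltrace_frame (F : fieldType) (V : vectType F) (I : finType) (e : I -> V)
    (c : I -> V -> F) (f : 'End(V)) :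
  (forall i, linear (c i : V -> F^o)) -> (forall x, x = \sum_i c i x *: e i) ->
  ltrace f = \sum_i c i (f (e i)).
Proof.
move=> lin frame; rewrite /ltrace.
under eq_bigr => k _ do
  rewrite [in f _](frame (vbasis {:V})`_k) linear_sum linear_sum.
rewrite exchange_big; apply: eq_bigr => i _ /=.
under eq_bigr => k _ do rewrite linearZ linearZ /= mulrC.
by rewrite -scalar_sum // -coord_vbasis // memvf.
Qed.

Lemma ltraceC (F : fieldType) (U V : vectType F) (f : 'Hom(U, V))
    (g : 'Hom(V, U)) : ltrace (f \o g) = ltrace (g \o f).
Proof.
rewrite /ltrace.
under eq_bigr => i _ do rewrite comp_lfunE
  (coord_vbasis (memvf (g _))) linear_sum linear_sum.
under [RHS]eq_bigr => i _ do rewrite comp_lfunE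
  (coord_vbasis (memvf (f _))) linear_sum linear_sum.
rewrite exchange_big; apply: eq_bigr => i _; apply: eq_bigr => j _ /=.
by rewrite !linearZ /= mulrC.
Qed.

Lemma ltraceD (F : fieldType) (V : vectType F) (f g : 'End(V)) :
  ltrace (f + g) = ltrace f + ltrace g.
Proof.
rewrite /ltrace -big_split; apply: eq_bigr => i _ /=.
by rewrite add_lfunE linearD.
Qed.

Lemma ltraceZ (F : fieldType) (V : vectType F) k (f : 'End(V)) :
  ltrace (k *: f) = k * ltrace f.
Proof.
rewrite /ltrace mulr_sumr; apply: eq_bigr => i _.
by rewrite scale_lfunE linearZ.
Qed.

(** * The ideal of negligible morphisms *)

Lemma c3_morE (F : fieldType) (X Y : C3rep F) (f : 'Hom(X, Y)) :
  c3_mor f <-> forall x, f (c3_act X x) = c3_act Y (f x).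
Proof.
split=> [/lfunP fP x|fP]; first by have := fP x; rewrite !comp_lfunE.
by apply/lfunP => x; rewrite !comp_lfunE fP.
Qed.

Lemma c3_mor_id (F : fieldType) (X : C3rep F) :
  c3_mor (\1%VF : 'Hom(X, X)).
Proof. by apply/c3_morE => x; rewrite !id_lfunE. Qed.

Lemma c3_mor_comp (F : fieldType) (X Y Z : C3rep F) (f : 'Hom(Y, Z))
    (g : 'Hom(X, Y)) : c3_mor f -> c3_mor g -> c3_mor (f \o g)%VF.
Proof.
by move=> /c3_morE fP /c3_morE gP; apply/c3_morE => x; rewrite !comp_lfunE gP fP.
Qed.

Lemma c3_mor_tmap (F : fieldType) (X Y X' Y' : C3rep F) (f : 'Hom(X, X'))
    (g : 'Hom(Y, Y')) : c3_mor f -> c3_mor g ->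
  @c3_mor F (c3_tens X Y) (c3_tens X' Y') (tmap f g).
Proof.
move=> /c3_morE fP /c3_morE gP; apply: tens_ext => x y /=.
by rewrite !comp_lfunE !tmapE fP gP.
Qed.

Lemma negligibleD (F : fieldType) (X Y : C3rep F) (f g : 'Hom(X, Y)) :
  negligible f -> negligible g -> negligible (f + g).
Proof. by move=> f0 g0 h hm; rewrite comp_lfunDl ltraceD f0 ?g0 ?addr0. Qed.

Lemma negligibleZ (F : fieldType) (X Y : C3rep F) k (f : 'Hom(X, Y)) :
  negligible f -> negligible (k *: f).
Proof. by move=> f0 h hm; rewrite -comp_lfunZl ltraceZ f0 ?mulr0. Qed.

Lemma negligible0 (F : fieldType) (X Y : C3rep F) :
  negligible (0 : 'Hom(X, Y)).
Proof.
by move=> h _; rewrite comp_lfun0l -(scale0r 0) ltraceZ mul0r.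
Qed.

Lemma negligible_compl (F : fieldType) (X Y Z : C3rep F) (h : 'Hom(Y, Z))
    (f : 'Hom(X, Y)) : c3_mor h -> negligible f -> negligible (h \o f)%VF.
Proof.
move=> hm f0 g gm; rewrite ltraceC comp_lfunA ltraceC f0 //.
exact: c3_mor_comp.
Qed.

Lemma negligible_compr (F : fieldType) (X Y Z : C3rep F) (h : 'Hom(X, Y))
    (f : 'Hom(Y, Z)) : c3_mor h -> negligible f -> negligible (f \o h)%VF.
Proof. by move=> hm f0 g gm; rewrite -comp_lfunA f0 //; apply: c3_mor_comp. Qed.

(** As sigma^2 = sigma^-1, the three summands are the conjugates of a merely linear [h] by the
    powers of sigma. After composition with an equivariant map, cyclicity of the trace makes their
    traces equal. *)
Lemma negligible_transfer (F : fieldType) (char3 : 3%N \in [pchar F])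
    (X Y : C3rep F) (f h : 'Hom(X, Y)) :
  (forall x, f x = h x + c3_act Y (h (c3_act X (c3_act X x)))
                   + c3_act Y (c3_act Y (h (c3_act X x)))) ->
  negligible f.
Proof.
move=> fE g /c3_morE gm.
pose s := c3_act X; pose t := c3_act Y.
have -> : f = h + (t \o (h \o (s \o s)))%VF + ((t \o t) \o (h \o s))%VF.
  by apply/lfunP => x; rewrite fE !(add_lfunE, comp_lfunE).
have e1 : ltrace ((t \o (h \o (s \o s))) \o g)%VF = ltrace (h \o g).
  rewrite -comp_lfunA ltraceC; congr ltrace; apply/lfunP => y.
  by rewrite !comp_lfunE /s /t -!gm c3_act3E.
have e2 : ltrace (((t \o t) \o (h \o s)) \o g)%VF = ltrace (h \o g).
  rewrite -comp_lfunA ltraceC; congr ltrace; apply/lfunP => y.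
  by rewrite !comp_lfunE /s /t -!gm c3_act3E.
rewrite !comp_lfunDl !ltraceD e1 e2 -[ltrace _]mul1r -!mulrDl.
suff -> : (1 + 1 + 1 : F) = 0 by rewrite mul0r.
by have := pcharf0 char3; rewrite !mulrS mulr0n addr0 addrA.
Qed.

(** * Partial traces, and closure of negligible morphisms under tensor products *)

Definition tcoord (F : fieldType) (U V : vectType F) (i : 'I_(\dim {:U}))
    (j : 'I_(\dim {:V})) (m : tens U V) : F := (m : 'M[F]_(_, _)) i j.

Lemma tcoord_linear (F : fieldType) (U V : vectType F) i j :
  linear (@tcoord F U V i j : _ -> F^o).
Proof. by move=> k m n; rewrite /tcoord !mxE. Qed.

Lemma ltrace_tens (F : fieldType) (U V : vectType F) (f : 'End(tens U V)) :
  ltrace f = \sum_i \sum_j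
    tcoord i j (f (tpure (vbasis {:U})`_i (vbasis {:V})`_j)).
Proof.
rewrite pair_big /=.
rewrite (@ltrace_frame _ _ _
  (fun p : 'I_(\dim {:U}) * 'I_(\dim {:V}) =>
     tpure (vbasis {:U})`_p.1 (vbasis {:V})`_p.2)
  (fun p => tcoord p.1 p.2)) //.
  by move=> p; apply: tcoord_linear.
by move=> m; rewrite {1}[m]tens_basis pair_big.
Qed.

Definition contract (F : fieldType) (U V : vectType F) (c : V -> F) :
    'Hom(tens U V, U) := tlift (fun u v => c v *: u).

Lemma contractE (F : fieldType) (U V : vectType F) (c : V -> F) (u : U) v :
  linear (c : V -> F^o) -> contract U c (tpure u v) = c v *: u.
Proof.
move=> lin; rewrite /contract tliftE //; split=> [x|y] a b d /=.
  by rewrite lin scalerDl scalerA.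
by rewrite scalerDr !scalerA mulrC.
Qed.

Lemma coord_linear (F : fieldType) (V : vectType F) n (b : n.-tuple V) i :
  linear (coord b i : V -> F^o).
Proof. by move=> a x y; rewrite linearP. Qed.

Definition ptrace (F : fieldType) (X Y Z : vectType F)
    (g : 'Hom(tens Y Z, tens X Z)) : 'Hom(Y, X) :=
  linfun (fun y => \sum_j contract X (coord (vbasis {:Z}) j)
                     (g (tpure y (vbasis {:Z})`_j))).

Lemma ptraceE (F : fieldType) (X Y Z : vectType F)
    (g : 'Hom(tens Y Z, tens X Z)) y :
  ptrace g y = \sum_j contract X (coord (vbasis {:Z}) j)
                     (g (tpure y (vbasis {:Z})`_j)).
Proof.
rewrite /ptrace linfunE // => k a b; rewrite scaler_sumr -big_split.
apply: eq_bigr => j _ /=; have [_ tl] := tpure_bilin Y Z.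
by rewrite tl !linearP.
Qed.

Lemma ptrace_mor (F : fieldType) (X Y Z : C3rep F)
    (g : 'Hom(tens Y Z, tens X Z)) :
  @c3_mor F (c3_tens Y Z) (c3_tens X Z) g -> c3_mor (ptrace g).
Proof.
move=> /c3_morE gm; apply/c3_morE => y; rewrite !ptraceE.
pose s := c3_act Z; pose z j := (vbasis {:Z})`_j.
pose c j := coord (vbasis {:Z}) j.
have cl j : linear (c j : Z -> F^o) by apply: coord_linear.
have gE j : g (tpure (c3_act Y y) (z j)) =
    \sum_k c k (s (s (z j))) *: c3_act (c3_tens X Z) (g (tpure y (z k))).
  rewrite -[z j in LHS]c3_act3E -tmapE gm.
  rewrite [in LHS](coord_vbasis (memvf (c3_act Z _))) tpure_sumr.
  by rewrite !linear_sum; apply: eq_bigr => k _; rewrite tpureZr !linearZ.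
under eq_bigr => j _ do rewrite gE linear_sum.
rewrite exchange_big linear_sum; apply: eq_bigr => k _ /=.
under eq_bigr => j _ do rewrite linearZ.
move: (g _) => /= m.
(* Expanding [s w] in the basis, the sum over [j] recombines to [c k (s (s (s w)))], and [s] has
   order 3. *)
have e : (\sum_(j < \dim {:Z}) c k (s (s (z j))) *: (contract X (c j) \o
    tmap (c3_act X) s))%VF = (c3_act X \o contract X (c k))%VF.
  apply: tens_ext => x w; rewrite sum_lfunE comp_lfunE contractE // linearZ /=.
  under eq_bigr => j _ do
    rewrite scale_lfunE comp_lfunE tmapE contractE // scalerA mulrC.
  rewrite -scaler_suml -(scalar_sum _ _ _ _ (cl k)); congr (c k _ *: _).
  rewrite -[RHS]c3_act3E [c3_act Z w in RHS](coord_vbasis (memvf _)).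
  by rewrite !linear_sum; apply: eq_bigr => j _; rewrite !linearZ.
have /lfunP/(_ m) := e; rewrite comp_lfunE sum_lfunE => <-.
by apply: eq_bigr => j _; rewrite scale_lfunE comp_lfunE.
Qed.

Lemma tmap_idE (F : fieldType) (X Y Z : vectType F) (f : 'Hom(X, Y)) i j
    (m : tens X Z) :
  tcoord i j (tmap f (\1%VF : 'End(Z)) m) =
  coord (vbasis {:Y}) i (f (contract X (coord (vbasis {:Z}) j) m)).
Proof.
have cl k := coord_linear (vbasis {:Z}) k.
rewrite [m]tens_basis !linear_sum /= /tcoord summxE; apply: eq_bigr => k _.
rewrite !linear_sum /= summxE; apply: eq_bigr => l _.
by rewrite !linearZ /= mxE tmapE id_lfunE !mxE contractE //
  !linearZ /= [X in _ * X]mulrC.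
Qed.

(** The trace of (f (x) 1) g is that of f composed with the partial trace of g over Z, which is
    again equivariant. *)
Lemma negligible_tmapl (F : fieldType) (X Y Z : C3rep F) (f : 'Hom(X, Y)) :
  negligible f ->
  @negligible F (c3_tens X Z) (c3_tens Y Z) (tmap f \1%VF).
Proof.
move=> f0 g gm; rewrite -(f0 _ (ptrace_mor gm)) ltrace_tens /ltrace.
apply: eq_bigr => i _; rewrite comp_lfunE ptraceE !linear_sum.
by apply: eq_bigr => j _; rewrite comp_lfunE tmap_idE.
Qed.

Definition tswap (F : fieldType) (U V : vectType F) :
    'Hom(tens U V, tens V U) := tlift (fun u v => tpure v u).

Lemma tswapE (F : fieldType) (U V : vectType F) (u : U) (v : V) :
  tswap U V (tpure u v) = tpure v u.
Proof.
by rewrite /tswap tliftE //; have [tr tl] := tpure_bilin V U; split.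
Qed.

Lemma c3_mor_tswap (F : fieldType) (X Y : C3rep F) :
  @c3_mor F (c3_tens X Y) (c3_tens Y X) (tswap X Y).
Proof.
by apply: tens_ext => x y; rewrite !comp_lfunE /= tmapE !tswapE tmapE.
Qed.

Lemma negligible_tmapr (F : fieldType) (X Y Z : C3rep F) (f : 'Hom(X, Y)) :
  negligible f ->
  @negligible F (c3_tens Z X) (c3_tens Z Y) (tmap \1%VF f).
Proof.
move=> f0; have -> : tmap \1%VF f =
    (tswap Y Z \o (tmap f \1%VF \o tswap Z X))%VF.
  by apply: tens_ext => z x; rewrite !comp_lfunE tswapE !tmapE tswapE.
apply: (@negligible_compl _ (c3_tens Z X) (c3_tens Y Z)).
  exact: c3_mor_tswap.
apply: (@negligible_compr _ _ (c3_tens X Z)); first exact: c3_mor_tswap.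
exact: negligible_tmapl.
Qed.

Lemma negligible_transfer_tens (F : fieldType) (char3 : 3%N \in [pchar F])
    (X Y Z : C3rep F) (f h : 'Hom(tens X Y, Z)) :
  (forall x y, f (tpure x y) = h (tpure x y)
     + c3_act Z (h (tpure (c3_act X (c3_act X x)) (c3_act Y (c3_act Y y))))
     + c3_act Z (c3_act Z (h (tpure (c3_act X x) (c3_act Y y))))) ->
  @negligible F (c3_tens X Y) Z f.
Proof.
move=> fE; apply: (@negligible_transfer F char3 (c3_tens X Y) Z f h) => m.
pose s : 'End(tens X Y) := tmap (c3_act X) (c3_act Y).
pose t := c3_act Z.
have e : f = (h + (t \o (h \o (s \o s))) + (t \o (t \o (h \o s))))%VF.
  apply: tens_ext => x y; rewrite fE !(add_lfunE, comp_lfunE).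
  by rewrite /s !tmapE.
by rewrite {1}e !(add_lfunE, comp_lfunE).
Qed.

(** * Triple tensor products, reassociation and permutation *)

Lemma tens_ext3 (F : fieldType) (U V W Z : vectType F)
    (f g : 'Hom(tens U (tens V W), Z)) :
  (forall u v w, f (tpure u (tpure v w)) = g (tpure u (tpure v w))) -> f = g.
Proof.
move=> fg; apply: tens_ext => u m; rewrite [m]tens_basis.
have [tr _] := tpure_bilin U (tens V W).
pose tu : 'Hom(tens V W, tens U (tens V W)) := linfun (tpure u).
have tuE n : tpure u n = tu n by rewrite /tu linfunE.
rewrite tuE !linear_sum; apply: eq_bigr => i _.
rewrite !linear_sum; apply: eq_bigr => j _.
by rewrite !linearZ /= -tuE fg.
Qed.

Definition tlift3 (F : fieldType) (U V W Z : vectType F) (b : U -> V -> W -> Z) :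
    'Hom(tens U (tens V W), Z) := tlift (fun u m => tlift (b u) m).

Lemma tlift3E (F : fieldType) (U V W Z : vectType F) (b : U -> V -> W -> Z) u v w :
  (forall u, bilin (b u)) -> (forall v w, linear (fun u => b u v w)) ->
  tlift3 b (tpure u (tpure v w)) = b u v w.
Proof.
move=> bb bl; rewrite /tlift3 tliftE; first exact: tliftE.
by split=> [x|m] k y z; [rewrite linearP | apply: tlift_linear].
Qed.

Definition tassoc (F : fieldType) (U V W : vectType F) :
    'Hom(tens U (tens V W), tens (tens U V) W) :=
  tlift3 (fun u v w => tpure (tpure u v) w).

Lemma tassocE (F : fieldType) (U V W : vectType F) (u : U) (v : V) (w : W) :
  tassoc U V W (tpure u (tpure v w)) = tpure (tpure u v) w.
Proof.
have [r1 l1] := tpure_bilin U V; have [r2 l2] := tpure_bilin (tens U V) W.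
by apply: tlift3E => [x|x y k p q]; [split=> [y|y] k p q|];
  rewrite ?r1 ?l1 ?r2 ?l2.
Qed.

Lemma c3_mor_tassoc (F : fieldType) (X Y Z : C3rep F) :
  @c3_mor F (c3_tens X (c3_tens Y Z)) (c3_tens (c3_tens X Y) Z) (tassoc X Y Z).
Proof.
by apply: tens_ext3 => x y z /=; rewrite !comp_lfunE !(tmapE, tassocE).
Qed.

Definition tperm12 (F : fieldType) (U V W : vectType F) :
    'Hom(tens U (tens V W), tens V (tens U W)) :=
  tlift3 (fun u v w => tpure v (tpure u w)).

Lemma tperm12E (F : fieldType) (U V W : vectType F) (u : U) (v : V) (w : W) :
  tperm12 U V W (tpure u (tpure v w)) = tpure v (tpure u w).
Proof.
have [r1 l1] := tpure_bilin U W; have [r2 l2] := tpure_bilin V (tens U W).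
by apply: tlift3E => [x|x y k p q]; [split=> [y|y] k p q|];
  rewrite ?r1 ?l1 ?r2 ?l2.
Qed.

Lemma c3_mor_tperm12 (F : fieldType) (X Y Z : C3rep F) :
  @c3_mor F (c3_tens X (c3_tens Y Z)) (c3_tens Y (c3_tens X Z)) (tperm12 X Y Z).
Proof.
by apply: tens_ext3 => x y z /=; rewrite !comp_lfunE !(tmapE, tperm12E).
Qed.

Lemma negligible_transfer_tens3 (F : fieldType) (char3 : 3%N \in [pchar F])
    (X Y Z W : C3rep F) (f h : 'Hom(tens X (tens Y Z), W)) :
  (forall x y z, f (tpure x (tpure y z)) = h (tpure x (tpure y z))
     + c3_act W (h (tpure (c3_act X (c3_act X x))
         (tpure (c3_act Y (c3_act Y y)) (c3_act Z (c3_act Z z)))))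
     + c3_act W (c3_act W (h (tpure (c3_act X x)
         (tpure (c3_act Y y) (c3_act Z z)))))) ->
  @negligible F (c3_tens X (c3_tens Y Z)) W f.
Proof.
move=> fE; apply: (@negligible_transfer F char3 (c3_tens X (c3_tens Y Z)) W f h)
  => m.
pose s : 'End(tens X (tens Y Z)) :=
  tmap (c3_act X) (tmap (c3_act Y) (c3_act Z)).
pose t := c3_act W.
have e : f = (h + (t \o (h \o (s \o s))) + (t \o (t \o (h \o s))))%VF.
  apply: tens_ext3 => x y z; rewrite fE !(add_lfunE, comp_lfunE).
  by rewrite /s !tmapE.
by rewrite {1}e !(add_lfunE, comp_lfunE).
Qed.

(** * Equality in Ver_3 as a congruence *)

Lemma ver3_eq_refl (F : fieldType) (X Y : C3rep F) (f : 'Hom(X, Y)) :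
  ver3_eq f f.
Proof. by rewrite /ver3_eq subrr; apply: negligible0. Qed.

Lemma ver3_eq_sym (F : fieldType) (X Y : C3rep F) (f g : 'Hom(X, Y)) :
  ver3_eq f g -> ver3_eq g f.
Proof.
by move=> fg; rewrite /ver3_eq -opprB -scaleN1r; apply: negligibleZ.
Qed.

Lemma ver3_eq_trans (F : fieldType) (X Y : C3rep F) (g f h : 'Hom(X, Y)) :
  ver3_eq f g -> ver3_eq g h -> ver3_eq f h.
Proof.
by move=> fg gh; rewrite /ver3_eq -(subrK g f) -addrA; apply: negligibleD.
Qed.

Lemma ver3_eqD (F : fieldType) (X Y : C3rep F) (f f' g g' : 'Hom(X, Y)) :
  ver3_eq f f' -> ver3_eq g g' -> ver3_eq (f + g) (f' + g').
Proof.
by move=> ff' gg'; rewrite /ver3_eq opprD addrACA; apply: negligibleD.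
Qed.

Lemma ver3_eq_compl (F : fieldType) (X Y Z : C3rep F) (h : 'Hom(Y, Z))
    (f g : 'Hom(X, Y)) :
  c3_mor h -> ver3_eq f g -> ver3_eq (h \o f)%VF (h \o g)%VF.
Proof.
move=> hm fg; have := negligible_compl hm fg.
by rewrite comp_lfunDr comp_lfunNr.
Qed.

Lemma ver3_eq_compr (F : fieldType) (X Y Z : C3rep F) (h : 'Hom(X, Y))
    (f g : 'Hom(Y, Z)) :
  c3_mor h -> ver3_eq f g -> ver3_eq (f \o h)%VF (g \o h)%VF.
Proof.
move=> hm fg; have := negligible_compr hm fg.
by rewrite comp_lfunDl comp_lfunNl.
Qed.

Lemma tmap_linear_l (F : fieldType) (U V U' V' : vectType F) (g : 'Hom(V, V')) :
  linear (fun f : 'Hom(U, U') => tmap f g).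
Proof.
move=> k f f'; apply: tens_ext => u v; have [_ tl] := tpure_bilin U' V'.
by rewrite add_lfunE scale_lfunE !tmapE add_lfunE scale_lfunE tl.
Qed.

Lemma tmap_linear_r (F : fieldType) (U V U' V' : vectType F) (f : 'Hom(U, U')) :
  linear (fun g : 'Hom(V, V') => tmap f g).
Proof.
move=> k g g'; apply: tens_ext => u v; have [tr _] := tpure_bilin U' V'.
by rewrite add_lfunE scale_lfunE !tmapE add_lfunE scale_lfunE tr.
Qed.

Lemma tmapBl (F : fieldType) (U V U' V' : vectType F) (f f' : 'Hom(U, U'))
    (g : 'Hom(V, V')) : tmap (f - f') g = tmap f g - tmap f' g.
Proof. by rewrite addrC -scaleN1r tmap_linear_l scaleN1r addrC. Qed.

Lemma tmapBr (F : fieldType) (U V U' V' : vectType F) (f : 'Hom(U, U'))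
    (g g' : 'Hom(V, V')) : tmap f (g - g') = tmap f g - tmap f g'.
Proof. by rewrite addrC -scaleN1r tmap_linear_r scaleN1r addrC. Qed.

Lemma tmap_comp (F : fieldType) (U V U' V' U'' V'' : vectType F)
    (f : 'Hom(U, U')) (g : 'Hom(V, V')) (f' : 'Hom(U', U''))
    (g' : 'Hom(V', V'')) :
  (tmap f' g' \o tmap f g)%VF = tmap (f' \o f)%VF (g' \o g)%VF.
Proof. by apply: tens_ext => u v; rewrite comp_lfunE !tmapE !comp_lfunE. Qed.

(** Passing through f' (x) g, the difference is (f - f') (x) g + f' (x) (g - g'); hence equivariance
    is asked of [f'] and [g]. *)
Lemma ver3_eq_tmap (F : fieldType) (X Y X' Y' : C3rep F) (f f' : 'Hom(X, X'))
    (g g' : 'Hom(Y, Y')) :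
  c3_mor f' -> c3_mor g -> ver3_eq f f' -> ver3_eq g g' ->
  @ver3_eq F (c3_tens X Y) (c3_tens X' Y') (tmap f g) (tmap f' g').
Proof.
move=> fm gm ff' gg'.
apply: (@ver3_eq_trans _ (c3_tens X Y) (c3_tens X' Y') (tmap f' g)).
  have -> : tmap f g = (tmap f \1 \o tmap \1 g)%VF.
    by rewrite tmap_comp comp_lfun1l comp_lfun1r.
  have -> : tmap f' g = (tmap f' \1 \o tmap \1 g)%VF.
    by rewrite tmap_comp comp_lfun1l comp_lfun1r.
  apply: (@ver3_eq_compr _ _ (c3_tens X Y')).
    by apply: c3_mor_tmap => //; apply: c3_mor_id.
  by rewrite /ver3_eq -tmapBl; apply: negligible_tmapl.
have -> : tmap f' g = (tmap f' \1 \o tmap \1 g)%VF.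
  by rewrite tmap_comp comp_lfun1l comp_lfun1r.
have -> : tmap f' g' = (tmap f' \1 \o tmap \1 g')%VF.
  by rewrite tmap_comp comp_lfun1l comp_lfun1r.
apply: (@ver3_eq_compl _ _ (c3_tens X Y')).
  by apply: c3_mor_tmap => //; apply: c3_mor_id.
by rewrite /ver3_eq -tmapBr; apply: negligible_tmapr.
Qed.

(* F(F^{1|1}) = 1 (+) V_1, with coordinates t0 on 1 and t1, t2 on v_0, v_1.
   The parity-indexed maps JT i j are the components 1, V_1 (x) V_1 -> 1, ... of
   J on its summands, extended by 0; KT i j are their inverses in Ver_3. *)
Definition T01 (F : fieldType) (char3 : 3%N \in [pchar F]) : C3rep F :=
  c3_sum (c3_triv F^o) (V1 char3).

(** * The test object 1 (+) V_1 and the structure maps between its summands *)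

Section T01.
Variables (F : fieldType) (char3 : 3%N \in [pchar F]).
Local Notation T := (T01 char3).

Definition t0 (x : T) : F := x.1.
Definition t1 (x : T) : F := x.2 0 0.
Definition t2 (x : T) : F := x.2 0 1.
Definition mkT (a b c : F) : T :=
  (a : F^o, \row_(j < 2) if j == 0 then b else c).

Arguments t0 : simpl never.
Arguments t1 : simpl never.
Arguments t2 : simpl never.
Arguments mkT : simpl never.

Lemma T_ext (x y : T) : t0 x = t0 y -> t1 x = t1 y -> t2 x = t2 y -> x = y.
Proof.
rewrite /t0 /t1 /t2; case: x y => [x u] [y v] /= -> e1 e2.
congr (_, _); apply/rowP => -[[|[|[]]] //= lt2].
  by rewrite (_ : Ordinal lt2 = 0) //; apply: val_inj.
by rewrite (_ : Ordinal lt2 = 1) //; apply: val_inj.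
Qed.

Lemma t0_mk a b c : t0 (mkT a b c) = a. Proof. by []. Qed.
Lemma t1_mk a b c : t1 (mkT a b c) = b. Proof. by rewrite /t1 mxE. Qed.
Lemma t2_mk a b c : t2 (mkT a b c) = c. Proof. by rewrite /t2 mxE. Qed.
Lemma t0D x y : t0 (x + y) = t0 x + t0 y. Proof. by []. Qed.
Lemma t1D x y : t1 (x + y) = t1 x + t1 y. Proof. by rewrite /t1 mxE. Qed.
Lemma t2D x y : t2 (x + y) = t2 x + t2 y. Proof. by rewrite /t2 mxE. Qed.
Lemma t0N x : t0 (- x) = - t0 x. Proof. by []. Qed.
Lemma t1N x : t1 (- x) = - t1 x. Proof. by rewrite /t1 mxE. Qed.
Lemma t2N x : t2 (- x) = - t2 x. Proof. by rewrite /t2 mxE. Qed.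
Lemma t0Z k x : t0 (k *: x) = k * t0 x. Proof. by []. Qed.
Lemma t1Z k x : t1 (k *: x) = k * t1 x. Proof. by rewrite /t1 mxE. Qed.
Lemma t2Z k x : t2 (k *: x) = k * t2 x. Proof. by rewrite /t2 mxE. Qed.
Lemma t0_0 : t0 0 = 0. Proof. by []. Qed.
Lemma t1_0 : t1 0 = 0. Proof. by rewrite /t1 mxE. Qed.
Lemma t2_0 : t2 0 = 0. Proof. by rewrite /t2 mxE. Qed.

Lemma t0_act x : t0 (c3_act T x) = t0 x.
Proof. by rewrite /t0 /= dmapE id_lfunE. Qed.

Lemma t1_act x : t1 (c3_act T x) = t1 x.
Proof.
rewrite /t1 /= dmapE /= lfunE /= mxE !big_ord_recl big_ord0 !mxE /=.
by rewrite mulr1 mulr0 !addr0.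
Qed.

Lemma t2_act x : t2 (c3_act T x) = t1 x + t2 x.
Proof.
rewrite /t2 /t1 /= dmapE /= lfunE /= mxE !big_ord_recl big_ord0 !mxE /=.
by rewrite !mulr1 addr0; congr (_ + x.2 _ _); apply: val_inj.
Qed.

Definition tE := (t0_mk, t1_mk, t2_mk, t0_act, t1_act, t2_act,
  (t0D, t1D, t2D), (t0N, t1N, t2N), (t0Z, t1Z, t2Z), (t0_0, t1_0, t2_0)).

Definition e0 := mkT 1 0 0.
Definition e1 := mkT 0 1 0.
Definition e2 := mkT 0 0 1.

Lemma T_dec x : x = t0 x *: e0 + t1 x *: e1 + t2 x *: e2.
Proof. by apply: T_ext; rewrite !tE; ring. Qed.

Lemma ltraceT (f : 'End(T)) : ltrace f = t0 (f e0) + t1 (f e1) + t2 (f e2).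
Proof.
rewrite (@ltrace_frame _ _ 'I_3 (fun i => nth 0 [:: e0; e1; e2] i)
  (fun i x => nth 0 [:: t0 x; t1 x; t2 x] i)) => [|i k x y|x].
- by rewrite !big_ord_recl big_ord0 /= addr0 addrA.
- by case: i => -[|[|[|]]] //= _; rewrite !tE.
- by rewrite !big_ord_recl big_ord0 /= addr0 addrA -T_dec.
Qed.

Definition piT_fun (i : bool) (x : T) : T :=
  if i then mkT 0 (t1 x) (t2 x) else mkT (t0 x) 0 0.
Definition piT i : 'End(T) := linfun (piT_fun i).
Lemma piTE i x : piT i x = piT_fun i x.
Proof.
by apply: linfunE => k y z; case: i; apply: T_ext; rewrite /= !tE; ring.
Qed.

Definition JT_fun (i j : bool) (x y : T) : T :=
  if i then
    if j then mkT (t1 x * t2 y - t2 x * t1 y) 0 0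
    else mkT 0 (t1 x * t0 y) (t2 x * t0 y)
  else
    if j then mkT 0 (t0 x * t1 y) (t0 x * t2 y)
    else mkT (t0 x * t0 y) 0 0.
Definition JT i j : 'Hom(tens T T, T) := tlift (JT_fun i j).
Lemma JTE i j x y : JT i j (tpure x y) = JT_fun i j x y.
Proof.
by apply: tliftE; split=> [u|v] k a b; case: i; case: j; apply: T_ext;
  rewrite /= !tE; ring.
Qed.

(* lambda(v_1 (x) v_0 - v_0 (x) v_1) = -2 = 1 *)
Definition KT_fun (i j : bool) (x : T) : tens T T :=
  if i then
    if j then t0 x *: (tpure e2 e1 - tpure e1 e2)
    else tpure (piT_fun true x) e0
  else
    if j then tpure e0 (piT_fun true x)
    else tpure (piT_fun false x) e0.
Definition KT i j : 'Hom(T, tens T T) := linfun (KT_fun i j).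

Lemma tcoordP (U V : vectType F) (m n : tens U V) :
  (forall i j, tcoord i j m = tcoord i j n) -> m = n.
Proof. by move=> mn; apply/matrixP => i j; apply: mn. Qed.

Lemma tcoordD (U V : vectType F) i j (m n : tens U V) :
  tcoord i j (m + n) = tcoord i j m + tcoord i j n.
Proof. by rewrite /tcoord mxE. Qed.
Lemma tcoordN (U V : vectType F) i j (m : tens U V) :
  tcoord i j (- m) = - tcoord i j m.
Proof. by rewrite /tcoord mxE. Qed.
Lemma tcoordZ (U V : vectType F) i j k (m : tens U V) :
  tcoord i j (k *: m) = k * tcoord i j m.
Proof. by rewrite /tcoord mxE. Qed.
(** The basis underlying [tens] is an abstract one, so the coordinates of [e0], [e1], [e2] in it are
    kept as unknowns. Identities in T (x) T become polynomial identities in these unknowns, within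
    reach of [ring]. *)
Lemma tcoord_pureT i j (x y : T) :
  let p k e := coord (vbasis {:T}) k e in
  tcoord i j (tpure x y) = (t0 x * p i e0 + t1 x * p i e1 + t2 x * p i e2)
    * (t0 y * p j e0 + t1 y * p j e1 + t2 y * p j e2).
Proof.
by move=> p; rewrite /tcoord mxE {1}[x]T_dec {1}[y]T_dec !linearD !linearZ.
Qed.
Definition tcE := (tcoordD, tcoordN, tcoordZ, tcoord_pureT).

Lemma KTE i j x : KT i j x = KT_fun i j x.
Proof.
apply: linfunE => k y z; apply: tcoordP => a b.
by case: i; case: j; rewrite /= !tcE !tE /=; ring.
Qed.

Lemma c3_mor_piT i : c3_mor (piT i).
Proof.
by apply/c3_morE => x; case: i; rewrite !piTE; apply: T_ext; rewrite /= !tE;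
  ring.
Qed.

Lemma c3_mor_JT i j : @c3_mor F (c3_tens T T) T (JT i j).
Proof.
apply: tens_ext => x y; rewrite !comp_lfunE tmapE !JTE.
by case: i; case: j; apply: T_ext; rewrite /= !tE; ring.
Qed.

Lemma c3_mor_KT i j : @c3_mor F T (c3_tens T T) (KT i j).
Proof.
apply/c3_morE => x; rewrite !KTE; case: i; case: j;
  rewrite /= ?linearZ ?linearB /= !tmapE; apply: tcoordP => a b;
  rewrite !tcE !tE; ring.
Qed.

Lemma char3E : 3%:R = 0 :> F.
Proof. exact: pcharf0. Qed.

(** Supplies the characteristic to [ring]: the witness [c] is the difference of the two sides,
    expanded with integer coefficients and divided by 3. *)
Lemma eq_char3 (a b c : F) : a - b = 3%:R * c -> a = b.
Proof. by rewrite char3E mul0r => /eqP; rewrite subr_eq0 => /eqP. Qed.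

Lemma JKT i j : (JT i j \o KT i j)%VF = piT (i (+) j).
Proof.
apply/lfunP => x; rewrite comp_lfunE KTE piTE; apply: T_ext.
all: case: i; case: j; rewrite /= ?linearZ ?linearB /= !JTE /= !tE; try ring.
by apply: (@eq_char3 _ _ (- t0 x)); ring.
Qed.

Lemma JT_tmap_pir i j : (JT i j \o tmap \1 (piT j))%VF = JT i j.
Proof.
apply: tens_ext => x y; rewrite comp_lfunE tmapE id_lfunE piTE !JTE.
by case: i; case: j; apply: T_ext; rewrite /= !tE; ring.
Qed.

Lemma KT_pi i j : (KT i j \o piT (i (+) j))%VF = KT i j.
Proof.
apply/lfunP => x; rewrite comp_lfunE piTE !KTE.
by case: i; case: j; rewrite /= ?tE.
Qed.

Lemma KJT i j :
  @ver3_eq F (c3_tens T T) (c3_tens T T) (KT i j \o JT i j)%VF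
    (tmap (piT i) (piT j)).
Proof.
have [/andP[]|ij] := boolP (i && j); last first.
  suff -> : (KT i j \o JT i j)%VF = tmap (piT i) (piT j).
    exact: ver3_eq_refl.
  apply: tens_ext => x y; rewrite comp_lfunE JTE KTE tmapE !piTE.
  by apply: tcoordP => a b; case: i j ij => -[] //= _; rewrite !tcE !tE; ring.
move=> -> ->.
(* On V1 (x) V1 the difference is 1 + swap, i.e. the projection on the free
   module S^2 V1, whose basis is the orbit of v_0 v_0. *)
pose h : 'Hom(tens T T, tens T T) :=
  tlift (fun x y : T => (t2 x * t2 y - t1 x * t1 y) *: tpure e1 e1).
have hE x y : h (tpure x y) = (t2 x * t2 y - t1 x * t1 y) *: tpure e1 e1.
  rewrite /h tliftE //; split=> [u|v] k a b;
    by apply: tcoordP => r s; rewrite /= !tcE !tE; ring.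
(* The form [t1 x * t1 y - t2 x * t2 y] is 1 on v_0 v_0 and 0 on its two other translates, so it is
   the coordinate along v_0 v_0 in the orbit basis. The opposite sign in [h] is the value 2 = -1 of
   1 + swap on symmetric tensors. *)
apply: (@negligible_transfer_tens F char3 T T (c3_tens T T) _ h) => x y.
have SE k u v : c3_act (c3_tens T T) (k *: tpure u v) =
    k *: tpure (c3_act T u) (c3_act T v).
  by rewrite linearZ /= tmapE.
rewrite !(add_lfunE, opp_lfunE, comp_lfunE) tmapE JTE KTE !piTE.
rewrite !hE !SE; apply: tcoordP => r s; rewrite !tcE !tE.
set r1 := coord _ r e1; set r2 := coord _ r e2.
set s1 := coord _ s e1; set s2 := coord _ s e2.
apply: (@eq_char3 _ _ (- ((t1 x + t2 x) * (t1 y + t2 y) * (r1 + r2) * (s1 + s2)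
  + r1 * s2 * t1 x * t2 y + r2 * s1 * t2 x * t1 y
  + r2 * s2 * (t1 x * t2 y + t2 x * t1 y + t2 x * t2 y)))).
ring.
Qed.

Definition J3T i j k : 'Hom(tens T (tens T T), T) :=
  (JT i (j (+) k) \o tmap \1 (JT j k))%VF.

Lemma J3TE i j k x y z :
  J3T i j k (tpure x (tpure y z)) = JT_fun i (j (+) k) x (JT_fun j k y z).
Proof. by rewrite comp_lfunE tmapE id_lfunE !JTE. Qed.

(* The left-hand side represents the symmetrisation of its first two arguments,
   followed by the form on the last two. *)
Lemma negligible_sym3 (f : 'Hom(tens T (tens T T), T)) :
  (forall x y z, f (tpure x (tpure y z)) =
    JT_fun true false x (JT_fun true true y z) +
    JT_fun true false y (JT_fun true true x z)) ->
  @negligible F (c3_tens T (c3_tens T T)) T f.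
Proof.
(* [b] is [f] restricted to the v_0 v_0 component of the first two arguments: [f] sends v_0, v_0, z
   to 2 lambda(v_0, z) v_0 = - [t2 z] v_0, and the quadratic factor is minus the coordinate along
   v_0 v_0. *)
move=> fE; pose b (x y z : T) : T :=
  mkT 0 ((t2 x * t2 y - t1 x * t1 y) * t2 z) 0.
apply: (@negligible_transfer_tens3 F char3 T T T T f (tlift3 b)) => x y z.
have bE u v w : tlift3 b (tpure u (tpure v w)) = b u v w.
  by apply: tlift3E => [p|p q k l m]; last (apply: T_ext; rewrite !tE; ring);
    split=> [q|q] k l m; apply: T_ext; rewrite /= !tE; ring.
rewrite fE !bE; apply: T_ext; rewrite /JT_fun /b !tE.
- ring.
- apply: (@eq_char3 _ _ (- (2%:R * t1 x * t1 y * t1 z + 2%:R * t1 x * t2 y * t1 z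
    + t1 x * t2 y * t2 z + 2%:R * t2 x * t1 y * t1 z + t2 x * t1 y * t2 z
    + t2 x * t2 y * t1 z + t2 x * t2 y * t2 z))); ring.
- apply: (@eq_char3 _ _
    (- ((t1 x + t2 x) * (t1 y + t2 y) * (2%:R * t1 z + t2 z)))); ring.
Qed.

Lemma J3T_assoc i j k :
  @ver3_eq F (c3_tens T (c3_tens T T)) T
    (JT (i (+) j) k \o (tmap (JT i j) \1 \o tassoc T T T))%VF (J3T i j k).
Proof.
have E x y z : (JT (i (+) j) k \o (tmap (JT i j) \1 \o tassoc T T T))%VF
    (tpure x (tpure y z)) = JT_fun (i (+) j) k (JT_fun i j x y) z.
  by rewrite !comp_lfunE tassocE tmapE id_lfunE !JTE.
have [/and3P[]|ijk] := boolP [&& i, j & k].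
  move=> ii jj kk; rewrite ii jj kk in E *; apply: negligible_sym3 => x y z.
  rewrite add_lfunE opp_lfunE E J3TE /=; apply: T_ext; rewrite !tE; try ring.
    (* In dimension 2, lambda(x, y) z + lambda(y, z) x + lambda(z, x) y = 0. The associator is
       therefore lambda(x, z) y - 2 lambda(y, z) x, which differs from the symmetrised map by -3
       lambda(y, z) x. *)
    by apply: (@eq_char3 _ _ (- (t1 y * t2 z - t2 y * t1 z) * t1 x)); ring.
  by apply: (@eq_char3 _ _ (- (t1 y * t2 z - t2 y * t1 z) * t2 x)); ring.
rewrite (_ : (_ \o _)%VF = J3T i j k); first exact: ver3_eq_refl.
apply: tens_ext3 => x y z; rewrite E J3TE.
by case: i j k {E} ijk => -[] [] //= _; apply: T_ext; rewrite !tE; ring.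
Qed.

(** For i, j odd and k even the sign is the skew-symmetry of lambda and holds strictly; when all
    three are odd, the two sides differ exactly by the symmetrised map of [negligible_sym3]. *)
Lemma J3T_perm i j k :
  @ver3_eq F (c3_tens T (c3_tens T T)) T
    (JT j (i (+) k) \o (tmap \1 (JT i k) \o tperm12 T T T))%VF
    ((-1) ^+ (i && j) *: J3T i j k).
Proof.
have E x y z : (JT j (i (+) k) \o (tmap \1 (JT i k) \o tperm12 T T T))%VF
    (tpure x (tpure y z)) = JT_fun j (i (+) k) y (JT_fun i k x z).
  by rewrite !comp_lfunE tperm12E tmapE id_lfunE !JTE.
have [/and3P[]|ijk] := boolP [&& i, j & k].
  move=> ii jj kk; rewrite ii jj kk in E *; apply: negligible_sym3 => x y z.
  by rewrite add_lfunE opp_lfunE scale_lfunE expr1 scaleN1r opprK E J3TE addrC.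
rewrite (_ : (_ \o _)%VF = (-1) ^+ (i && j) *: J3T i j k).
  exact: ver3_eq_refl.
apply: tens_ext3 => x y z; rewrite scale_lfunE E J3TE.
by case: i j k {E} ijk => -[] [] //= _; apply: T_ext; rewrite !tE; ring.
Qed.

(** Iterating [KT] gives a section of [J3T i j k] over the summand of parity i + j + k, so
    [J3T i j k] cancels on the right there. *)
Lemma J3T_epi (Z : C3rep F) i j k (f g : 'Hom(T, Z)) :
  @ver3_eq F (c3_tens T (c3_tens T T)) Z (f \o J3T i j k)%VF (g \o J3T i j k)%VF ->
  ver3_eq (f \o piT (i (+) j (+) k))%VF (g \o piT (i (+) j (+) k))%VF.
Proof.
pose K : 'Hom(T, tens T (tens T T)) :=
  (tmap \1 (KT j k) \o KT i (j (+) k))%VF.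
have JK : (J3T i j k \o K)%VF = piT (i (+) j (+) k).
  rewrite /J3T /K -comp_lfunA [X in (_ \o X)%VF]comp_lfunA tmap_comp JKT.
  by rewrite comp_lfun1l comp_lfunA JT_tmap_pir JKT addbA.
have Km : @c3_mor F T (c3_tens T (c3_tens T T)) K.
  apply: (@c3_mor_comp _ _ (c3_tens T T)); last exact: c3_mor_KT.
  by apply: (@c3_mor_tmap _ T T T (c3_tens T T));
    [apply: c3_mor_id|apply: c3_mor_KT].
move=> fg; rewrite -JK (comp_lfunA f) (comp_lfunA g).
exact: (@ver3_eq_compr F T (c3_tens T (c3_tens T T)) Z K _ _ Km fg).
Qed.

End T01.

(** * Products in Ver_3 evaluated on homogeneous elements *)

Section Compat.
Variables (F : fieldType) (char3 : 3%N \in [pchar F]).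
Local Notation T := (T01 char3).
Local Notation JT := (JT char3).
Local Notation KT := (KT char3).
Local Notation piT := (piT char3).
Local Notation J3T := (J3T char3).
Implicit Types X Y Z : C3rep F.

(* z is the product under m of the parity-i map x and the parity-j map y. *)
Definition compat i j X Y Z (m : 'Hom(tens X Y, Z)) (x : 'Hom(T, X))
    (y : 'Hom(T, Y)) (z : 'Hom(T, Z)) : Prop :=
  @ver3_eq F (c3_tens T T) Z (z \o JT i j)%VF (m \o tmap x y)%VF.

(** With [compat_left] and [compat_perm], this brings the nested products x (y1 y2), (x1 x2) y and
    y1 (x y2) over the same map [J3T i j k], where they can be added. The second costs an
    associator, the third a permutation and hence the sign. *)
Lemma compat_right i j k X Y1 Y2 Y Z (m : 'Hom(tens X Y, Z))
    (n : 'Hom(tens Y1 Y2, Y)) (x : 'Hom(T, X)) (y1 : 'Hom(T, Y1))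
    (y2 : 'Hom(T, Y2)) (y : 'Hom(T, Y)) (z : 'Hom(T, Z)) :
  @c3_mor F (c3_tens X Y) Z m -> c3_mor x -> c3_mor y ->
  compat i (j (+) k) m x y z -> compat j k n y1 y2 y ->
  @ver3_eq F (c3_tens T (c3_tens T T)) Z (z \o J3T i j k)%VF
    (m \o tmap x (n \o tmap y1 y2))%VF.
Proof.
move=> mm xm ym cz cy.
have Jm : @c3_mor F (c3_tens T (c3_tens T T)) (c3_tens T T) (tmap \1 (JT j k)).
  by apply: (@c3_mor_tmap _ T (c3_tens T T)); [apply: c3_mor_id|apply: c3_mor_JT].
have := @ver3_eq_compr F _ (c3_tens T T) Z _ _ _ Jm cz.
rewrite -comp_lfunA -[X in ver3_eq _ X]comp_lfunA tmap_comp comp_lfun1r => e.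
apply: ver3_eq_trans e _; apply: (@ver3_eq_compl _ _ (c3_tens X Y)) => //.
apply: (@ver3_eq_tmap F T (c3_tens T T)) => //; last exact: ver3_eq_refl.
by apply: (@c3_mor_comp F (c3_tens T T)) => //; apply: c3_mor_JT.
Qed.

Lemma compat_left i j k X1 X2 X Y Z (m : 'Hom(tens X Y, Z))
    (n : 'Hom(tens X1 X2, X)) (x1 : 'Hom(T, X1)) (x2 : 'Hom(T, X2))
    (x : 'Hom(T, X)) (y : 'Hom(T, Y)) (z : 'Hom(T, Z)) :
  @c3_mor F (c3_tens X Y) Z m -> @c3_mor F (c3_tens X1 X2) X n ->
  c3_mor x1 -> c3_mor x2 -> c3_mor y -> c3_mor z ->
  compat (i (+) j) k m x y z -> compat i j n x1 x2 x ->
  @ver3_eq F (c3_tens T (c3_tens T T)) Z (z \o J3T i j k)%VF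
    (m \o (tmap (n \o tmap x1 x2) y \o tassoc T T T))%VF.
Proof.
move=> mm nm x1m x2m ym zm cz cx.
have Jm : @c3_mor F (c3_tens T (c3_tens T T)) (c3_tens T T)
    (tmap (JT i j) \1 \o tassoc T T T).
  apply: (@c3_mor_comp F _ (c3_tens (c3_tens T T) T)); last exact: c3_mor_tassoc.
  by apply: (@c3_mor_tmap _ (c3_tens T T) T T T);
    [apply: c3_mor_JT|apply: c3_mor_id].
have := @ver3_eq_compl F (c3_tens T (c3_tens T T)) T Z _ _ _ zm
  (@J3T_assoc F char3 i j k).
move/ver3_eq_sym/ver3_eq_trans; apply.
have := @ver3_eq_compr F _ (c3_tens T T) Z _ _ _ Jm cz.
rewrite -comp_lfunA => e; apply: ver3_eq_trans e _.
rewrite -comp_lfunA; apply: (@ver3_eq_compl _ _ (c3_tens X Y)) => //.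
rewrite comp_lfunA tmap_comp comp_lfun1r.
apply: (@ver3_eq_compr _ _ (c3_tens (c3_tens T T) T)); first exact: c3_mor_tassoc.
apply: (@ver3_eq_tmap F (c3_tens T T) T X Y) => //; last exact: ver3_eq_refl.
apply: (@c3_mor_comp F (c3_tens T T) (c3_tens X1 X2)) => //.
exact: c3_mor_tmap.
Qed.

Lemma compat_perm i j k X Y1 Y2 Y Z (m : 'Hom(tens Y1 Y, Z))
    (n : 'Hom(tens X Y2, Y)) (x : 'Hom(T, X)) (y1 : 'Hom(T, Y1))
    (y2 : 'Hom(T, Y2)) (y : 'Hom(T, Y)) (z : 'Hom(T, Z)) :
  @c3_mor F (c3_tens Y1 Y) Z m -> c3_mor y1 -> c3_mor y -> c3_mor z ->
  compat j (i (+) k) m y1 y z -> compat i k n x y2 y ->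
  @ver3_eq F (c3_tens T (c3_tens T T)) Z ((-1) ^+ (i && j) *: z \o J3T i j k)%VF
    (m \o (tmap y1 (n \o tmap x y2) \o tperm12 T T T))%VF.
Proof.
move=> mm y1m ym zm cz cy.
have := @ver3_eq_compl F (c3_tens T (c3_tens T T)) T Z _ _ _ zm
  (@J3T_perm F char3 i j k).
rewrite -comp_lfunZr comp_lfunZl; move/ver3_eq_sym/ver3_eq_trans; apply.
have Pm := @c3_mor_tperm12 F T T T.
have := @compat_right j i k _ _ _ _ _ _ _ _ _ _ _ _ mm y1m ym cz cy.
move/(@ver3_eq_compr F _ (c3_tens T (c3_tens T T)) Z _ _ _ Pm).
by rewrite -!comp_lfunA.
Qed.

(* For s homogeneous of parity i, the morphism from the parity-i summand of T01
   to F(X) given by s, extended by 0. *)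
Definition elt (X : svec F) (s : stot X) : 'Hom(T, Ver char3 X) :=
  linfun (fun t : T => (t0 t *: s.1, tpure s.2 t.2) : Ver char3 X).

Lemma eltE (X : svec F) (s : stot X) t :
  elt s t = (t0 t *: s.1, tpure s.2 t.2).
Proof.
rewrite /elt linfunE // => k a b; have [tr _] := tpure_bilin (sod X) 'rV[F]_2.
by rewrite tE scalerDl -scalerA tr.
Qed.

Lemma elt_linear (X : svec F) : linear (@elt X).
Proof.
move=> k s s'; apply/lfunP => t; rewrite add_lfunE scale_lfunE !eltE.
have [_ tl] := tpure_bilin (sod X) 'rV[F]_2.
by congr (_, _); rewrite /= ?tl // scalerDr !scalerA mulrC.
Qed.

Lemma c3_mor_elt (X : svec F) (s : stot X) : c3_mor (elt s).
Proof.
apply/c3_morE => t; rewrite !eltE tE /= !dmapE /= !id_lfunE.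
by rewrite tmapE id_lfunE.
Qed.

Lemma mkT_snd a (t : T) : (mkT char3 a (t1 t) (t2 t)).2 = t.2.
Proof.
suff -> : mkT char3 a (t1 t) (t2 t) = (a : F^o, t.2) by [].
by apply: T_ext; rewrite ?tE.
Qed.

Lemma elt_pi (X : svec F) i (s : stot X) :
  s \in shom X i -> (elt s \o piT i)%VF = elt s.
Proof.
rewrite mem_shom; case: s => s0 s1; case: i => /= /eqP ->;
  apply/lfunP => t; rewrite comp_lfunE piTE !eltE /piT_fun.
  by rewrite mkT_snd !scaler0.
by rewrite tE !tpure0l.
Qed.

Definition sapp2 (X Y Z : svec F) (w : smor (stens X Y) Z) (x : stot X)
    (y : stot Y) : stot Z :=
  (w.1 (tpure x.1 y.1, tpure x.2 y.2), w.2 (tpure x.1 y.2, tpure x.2 y.1)).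

(** A strict equality: on summands of parities i and j, J is [JT i j] with the coefficient vectors
    carried along. It turns equations between morphisms out of F(X) (x) F(Y) into [compat]
    relations. *)
Lemma Ver_map_elt (X Y Z : svec F) (w : smor (stens X Y) Z) i j
    (x : stot X) (y : stot Y) : x \in shom X i -> y \in shom Y j ->
  ((Ver_map char3 w \o Ver_J char3 X Y) \o tmap (elt x) (elt y))%VF =
  (elt (sapp2 w x y) \o JT i j)%VF.
Proof.
rewrite !mem_shom; case: x y => x0 x1 [y0 y1] /= hx hy; apply: tens_ext => s t.
rewrite !comp_lfunE tmapE !eltE JTE /= Ver_JE /Ver_map dmapE /sapp2 /=.
rewrite linearD /= !tmapE !id_lfunE.
have pl (U V : vectType F) c (u : U) : (c *: u, 0 : V) = c *: (u, 0 : V).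
  by congr (_, _); rewrite /= scaler0.
have pr (U V : vectType F) c (v : V) : (0 : U, c *: v) = c *: (0 : U, v).
  by congr (_, _); rewrite /= scaler0.
have rowZ c (u : T) : (c *: u).2 = \row_j (if j == 0 then c * t1 u else c * t2 u).
  by rewrite -(mkT_snd (t0 (c *: u))) !tE.
case: i hx => /eqP ->; case: j hy => /eqP ->.
all: rewrite /= ?tE ?(scaler0, tpure0l, tpure0r, tpureZl, tpureZr, linear0,
  scale0r, addr0, add0r) /=.
all: rewrite ?(pl, pr) linearZ /= ?tpureZl.
- by rewrite pl.
- rewrite -tpureZr; congr (_, tpure _ _).
  by rewrite -[LHS]/((t0 t *: s).2) rowZ; apply/rowP => k;
    rewrite !mxE !(mulrC (t0 t)).
- by rewrite -tpureZr -rowZ.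
- by rewrite !pl linearZ /= pl scalerA.
Qed.

(** * Elements of X as the morphisms from the test object to F(X) *)

Definition vcontract (U : vectType F) (c : U -> F) :
    'Hom(tens U 'rV[F]_2, 'rV[F]_2) := tlift (fun x u => c x *: u).

Lemma vcontractE (U : vectType F) (c : U -> F) x u :
  linear (c : U -> F^o) -> vcontract c (tpure x u) = c x *: u.
Proof.
move=> lin; rewrite /vcontract tliftE //; split=> [y|y] a b d /=.
  by rewrite scalerDr !scalerA mulrC.
by rewrite lin scalerDl scalerA.
Qed.

Definition Ver_proj (X : svec F) (a : sev X -> F) (b : sod X -> F) :
    'Hom(Ver char3 X, T) :=
  linfun (fun z : Ver char3 X => (a z.1 : F^o, vcontract b z.2) : T).

Section Proj.
Variables (X : svec F) (a : sev X -> F) (b : sod X -> F).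
Hypotheses (al : linear (a : sev X -> F^o)) (bl : linear (b : sod X -> F^o)).

Lemma Ver_projE z : Ver_proj a b z = (a z.1 : F^o, vcontract b z.2).
Proof.
by rewrite /Ver_proj linfunE // => k x y; congr (_, _); rewrite /= ?al ?linearP.
Qed.

Lemma c3_mor_Ver_proj : c3_mor (Ver_proj a b).
Proof.
have e : (vcontract b \o tmap \1 (V1_act F) = V1_act F \o vcontract b)%VF.
  apply: tens_ext => x u; rewrite !comp_lfunE tmapE id_lfunE !vcontractE //.
  by rewrite linearZ.
apply/c3_morE => z; rewrite !Ver_projE /= !dmapE /= !id_lfunE.
by have /lfunP/(_ z.2) := e; rewrite !comp_lfunE => ->.
Qed.

Lemma Ver_proj_elt s t :
  Ver_proj a b (elt s t) = (a s.1 * t0 t : F^o, b s.2 *: t.2).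
Proof.
rewrite Ver_projE eltE /= vcontractE //; congr (_, _).
by have := al (t0 t) s.1 0; rewrite addr0 mulrC => ->;
  rewrite (linear_fun0 al) addr0.
Qed.
End Proj.

(** Composing with [Ver_proj a b] gives the trace a(s_0) + 2 b(s_1), where 2 = dim V_1 equals -1.
    Taking one functional zero and the other a coordinate kills each coordinate of [s]. *)
Lemma elt_eq0 (X : svec F) (s : stot X) :
  negligible (elt s) -> s = 0.
Proof.
move=> s0.
have tr (a : sev X -> F) (b : sod X -> F) :
    linear (a : sev X -> F^o) -> linear (b : sod X -> F^o) -> a s.1 = b s.2.
  move=> al bl; have := s0 _ (c3_mor_Ver_proj al bl).
  rewrite ltraceC ltraceT !comp_lfunE !Ver_proj_elt //.
  rewrite /t0 /t1 /t2 !mxE /= !mulr1 => e.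
  apply: (@eq_char3 _ char3 _ _ (- b s.2)); rewrite -[LHS]addr0 -oppr0 -e; ring.
have z (V : vectType F) : linear ((fun _ : V => 0) : V -> F^o).
  by move=> k x y /=; rewrite scaler0 addr0.
case: s {s0} tr => x y /= tr; congr (_, _).
  rewrite [x](coord_vbasis (memvf x)) big1 // => i _.
  by rewrite (tr _ _ (coord_linear _ i) (z _)) scale0r.
rewrite [y](coord_vbasis (memvf y)) big1 // => i _.
by rewrite -(tr _ _ (z _) (coord_linear _ i)) scale0r.
Qed.

Lemma tens_rV2 (U : vectType F) (m : tens U 'rV[F]_2) :
  let c k := contract U (fun u : 'rV[F]_2 => u 0 k) m in
  m = tpure (c 0) (delta_mx 0 0) + tpure (c 1) (delta_mx 0 1).
Proof.
have cl k : linear ((fun u : 'rV[F]_2 => u 0 k) : _ -> F^o).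
  by move=> a x y /=; rewrite !mxE.
pose q (k : 'I_2) : 'Hom(U, tens U 'rV[F]_2) :=
  linfun (fun x => tpure x (delta_mx 0 k)).
have qE k x : q k x = tpure x (delta_mx 0 k).
  by apply: linfunE; case: (tpure_bilin U 'rV[F]_2).
pose c k := contract U (fun u : 'rV[F]_2 => u 0 k).
have e : \1%VF = (q 0 \o c 0)%VF + (q 1 \o c 1)%VF.
  apply: tens_ext => x u; rewrite id_lfunE add_lfunE !comp_lfunE !qE !contractE //.
  rewrite ![tpure (_ *: x) _]tpureZl -!tpureZr.
  have [tr _] := tpure_bilin U 'rV[F]_2.
  rewrite addrC -[X in X + _]scale1r -tr; congr (tpure x _); rewrite scale1r.
  apply/rowP => -[[|[|[]]] //= lt2].
    by rewrite (_ : Ordinal lt2 = 0);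
    [rewrite !mxE /= mulr0 mulr1 add0r|apply: val_inj].
  by rewrite (_ : Ordinal lt2 = 1);
    [rewrite !mxE /= mulr0 mulr1 addr0|apply: val_inj].
move=> cc; rewrite -!qE; have /lfunP/(_ m) := e.
by rewrite id_lfunE add_lfunE !comp_lfunE.
Qed.

(* The inverse of elt in Ver_3, by ver3_eq_elt_rho. *)
Definition rho (X : svec F) (f : 'Hom(T, Ver char3 X)) : stot X :=
  ((f (e0 char3)).1,
   contract (sod X) (fun u : 'rV[F]_2 => u 0 0) (f (e1 char3)).2).

Lemma rho_linear (X : svec F) : linear (@rho X).
Proof.
move=> k f g; rewrite /rho !add_lfunE !scale_lfunE.
by congr (_, _); rewrite /= linearP.
Qed.

(* f - elt (rho f) has components in Hom(1, V_1), Hom(V_1, 1) and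
   Hom(., .) (x) (sigma - 1), all of which are negligible. *)
Lemma ver3_eq_elt_rho (X : svec F) (f : 'Hom(T, Ver char3 X)) :
  c3_mor f -> ver3_eq f (elt (rho f)).
Proof.
move=> fm g gm; rewrite ltraceC ltraceT !comp_lfunE.
pose D := f - elt (rho f).
have Dm : c3_mor D.
  have im := c3_mor_elt (rho f); apply/c3_morE => t.
  move/c3_morE: fm => fm; move/c3_morE: im => im.
  by rewrite /D !add_lfunE !opp_lfunE fm im linearB.
have gE z : g (c3_act _ z) = c3_act T (g z) by move/c3_morE: gm.
have DE z : D (c3_act T z) = c3_act _ (D z) by move/c3_morE: Dm.
pose v0 : 'rV[F]_2 := delta_mx 0 0; pose v1 : 'rV[F]_2 := delta_mx 0 1.
have actv0 : V1_act F v0 = v0 + v1.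
  apply/rowP => -[[|[|[]]] //= lt2];
    rewrite lfunE /= !mxE !big_ord_recl big_ord0 !mxE /=; ring.
have actv1 : V1_act F v1 = v1.
  apply/rowP => -[[|[|[]]] //= lt2];
    rewrite lfunE /= !mxE !big_ord_recl big_ord0 !mxE /=; ring.
have cl k : linear ((fun u : 'rV[F]_2 => u 0 k) : _ -> F^o).
  by move=> a x y /=; rewrite !mxE.
have actE (a : sev X) x0 x1 : c3_act (Ver char3 X)
    (a, tpure x0 v0 + tpure x1 v1) =
    (a, tpure x0 v0 + tpure x1 v1) + (0, tpure x0 v1).
  rewrite /= dmapE /= id_lfunE linearD /= !tmapE !id_lfunE actv0 actv1.
  congr (_, _); rewrite /= ?addr0 //.
  by rewrite tpureDr addrAC.
have gD u v : g (u + v) = g u + g v by rewrite linearD.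
(* As v_1 = (sigma - 1) v_0, the image lies in (sigma - 1) T, the line of v_1. In [gT] below, the
   image of a fixed vector is fixed, which forces its v_0 coefficient to vanish. *)
have gN x : t0 (g (0, tpure x v1)) = 0 /\ t1 (g (0, tpure x v1)) = 0.
  have := gE (0, tpure x v0 + tpure 0 v1).
  rewrite actE tpure0l addr0 gD => e.
  split; [move/(congr1 (@t0 F char3)): e|move/(congr1 (@t1 F char3)): e];
    rewrite !tE => /eqP;
    by rewrite -subr_eq0 addrAC subrr add0r => /eqP.
have gT a : t1 (g (a, 0)) = 0.
  have fixa : c3_act (Ver char3 X) (a, 0) = (a, 0).
    by rewrite /= dmapE /= id_lfunE linear0.
  have := gE (a, 0); rewrite fixa.
  move/(congr1 (@t2 F char3)); rewrite !tE => /eqP.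
  by rewrite -subr_eq0 opprD addrA addrAC subrr sub0r oppr_eq0 => /eqP.
have D0 : exists x, D (e0 char3) = (0, tpure x v1).
  pose c k := contract (sod X) (fun u : 'rV[F]_2 => u 0 k) (D (e0 char3)).2.
  have De : D (e0 char3) = (0, tpure (c 0) v0 + tpure (c 1) v1).
    rewrite -tens_rV2 [LHS]surjective_pairing; congr (_, _).
    by rewrite /D add_lfunE opp_lfunE eltE /rho /= scale1r subrr.
  have : D (e0 char3) = c3_act _ (D (e0 char3)).
    by rewrite -DE; congr (D _); apply: T_ext; rewrite !tE ?addr0.
  rewrite {2}De actE -De => /eqP;
    rewrite -subr_eq0 opprD addrA subrr sub0r oppr_eq0.
  move=> /eqP /(congr1 snd) /= c0.
  have := congr1 (contract (sod X) (fun u : 'rV[F]_2 => u 0 1)) c0.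
  rewrite contractE // linear0 mxE /= scale1r => c00.
  by exists (c 1); rewrite De c00 tpure0l add0r.
have [a [x D1]] : exists a x, D (e1 char3) = (a, tpure x v1).
  pose m : tens (sod X) 'rV[F]_2 := (D (e1 char3)).2.
  pose c k := contract (sod X) (fun u : 'rV[F]_2 => u 0 k).
  have m0 : c 0 m = 0.
    have -> : m = (f (e1 char3)).2 - tpure (rho f).2 (e1 char3).2.
      by rewrite /m /D add_lfunE opp_lfunE eltE.
    by rewrite linearB /= contractE // mxE /= scale1r subrr.
  exists (D (e1 char3)).1, (c 1 m); rewrite [LHS]surjective_pairing.
  by congr (_, _); rewrite -/m [LHS]tens_rV2 [contract _ _ m]m0 tpure0l add0r.
(* [e2] is (sigma - 1) [e1], and [D] sends [e1] to a fixed vector. *)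
have D2 : D (e2 char3) = 0.
  have -> : e2 char3 = c3_act T (e1 char3) - e1 char3.
    by apply: T_ext; rewrite !tE; ring.
  rewrite linearB /= DE D1 -[tpure x v1]add0r -(tpure0l (sod X) v0) actE.
  by rewrite addrAC subrr add0r tpure0l.
rewrite -!/D D2 linear0 tE addr0 D1.
have [y ->] := D0; have [-> _] := gN y; rewrite add0r.
rewrite -[a]addr0 -[tpure x v1]add0r (_ : (_, _) = (a, 0) + (0, tpure x v1)) //.
by rewrite gD tE gT; have [_ ->] := gN x; rewrite addr0.
Qed.
End Compat.

(** * Evaluation of derivations and of homogeneous superderivations *)

Lemma prod_tens_ext (F : fieldType) (U V U' V' W : vectType F)
    (f g : 'Hom((tens U V * tens U' V')%type, W)) :
  (forall u v, f (tpure u v, 0) = g (tpure u v, 0)) ->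
  (forall u v, f (0, tpure u v) = g (0, tpure u v)) -> f = g.
Proof.
move=> fg1 fg2.
pose i1 : 'Hom(tens U V, (tens U V * tens U' V')%type) :=
  linfun (fun x => (x, 0)).
pose i2 : 'Hom(tens U' V', (tens U V * tens U' V')%type) :=
  linfun (fun x => (0, x)).
have i1E x : i1 x = (x, 0).
  by apply: linfunE => k a b; congr (_, _); rewrite /= scaler0 addr0.
have i2E x : i2 x = (0, x).
  by apply: linfunE => k a b; congr (_, _); rewrite /= scaler0 addr0.
have e1 : (f \o i1)%VF = (g \o i1)%VF.
  by apply: tens_ext => u v; rewrite !comp_lfunE i1E.
have e2 : (f \o i2)%VF = (g \o i2)%VF.
  by apply: tens_ext => u v; rewrite !comp_lfunE i2E.
apply/lfunP => -[x y].
have -> : (x, y) = i1 x + i2 y.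
  by rewrite i1E i2E; congr (_, _); rewrite /= ?addr0 ?add0r.
have /lfunP/(_ x) := e1; have /lfunP/(_ y) := e2.
by rewrite !comp_lfunE !linearD /= => -> ->.
Qed.

Lemma der_evE (F : fieldType) (A : C3alg F) (d : Der A) (a : A) :
  der_ev A (tpure d a) = vsval d a.
Proof.
rewrite /der_ev tliftE //; split=> [x|x] k y z; first exact: linearP.
by rewrite linearP add_lfunE scale_lfunE.
Qed.

Lemma c3_mor_der_ev (F : fieldType) (A : C3alg F) :
  @c3_mor F (c3_tens (Der A) A) A (der_ev A).
Proof.
apply: tens_ext => d a; rewrite !comp_lfunE tmapE !der_evE /= der_actE.
by rewrite !comp_lfunE c3_actK.
Qed.

Section Super.
Variable F : fieldType.

Lemma sapp2_shom (X Y Z : svec F) (w : smor (stens X Y) Z) i j x y :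
  x \in shom X i -> y \in shom Y j -> sapp2 w x y \in shom Z (i (+) j).
Proof.
rewrite !mem_shom /sapp2; case: x y => x0 x1 [y0 y1] /= hx hy.
by case: i hx => /eqP ->; case: j hy => /eqP -> /=;
  rewrite !(tpure0l, tpure0r) linear0.
Qed.

(** The index [i] selects the component of [l], so this is the superderivation attached to [l] when
    [l] is homogeneous of parity [i]. *)
Definition smor_tot (L S : salg F) (Phi : smor L (sDer S)) (i : bool)
    (l : stot L) : 'End(stot S) :=
  if i then vsval (Phi.2 l.2) else vsval (Phi.1 l.1).

Lemma smor_tot_sder (L S : salg F) (Phi : smor L (sDer S)) i l :
  smor_tot Phi i l \in sder S i.
Proof. by case: i; apply: subvsP. Qed.

Lemma sder_shom (S : salg F) i j (d : 'End(stot S)) a :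
  d \in sder S i -> a \in shom S j -> d a \in shom S (i (+) j).
Proof.
by move=> /sderP [dS _] aj; rewrite addbC; apply: (subvP (dS j)); apply: memv_img.
Qed.

Lemma sapp2_comp (X Y X' Y' Z : svec F) (w : smor (stens X' Y') Z)
    (f : smor X X') (g : smor Y Y') x y :
  sapp2 (scomp w (stmap f g)) x y =
  sapp2 w ((f.1 x.1, f.2 x.2) : stot X') ((g.1 y.1, g.2 y.2) : stot Y').
Proof. by rewrite /sapp2 /= !comp_lfunE !dmapE /= !tmapE. Qed.

Lemma sapp2_ev (S : salg F) (d : stot (sDer S)) (a : stot S) :
  sapp2 (sder_ev S) d a =
  ((vsval d.1 (a.1, 0)).1 + (vsval d.2 (0, a.2)).1,
   (vsval d.1 (0, a.2)).2 + (vsval d.2 (a.1, 0)).2).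
Proof.
have p1 (x : sev S) k y : ((k *: x + y, 0) : stot S) = k *: (x, 0) + (y, 0).
  by congr (_, _); rewrite /= scaler0 addr0.
have p2 (x : sod S) k y : ((0, k *: x + y) : stot S) = k *: (0, x) + (0, y).
  by congr (_, _); rewrite /= scaler0 addr0.
rewrite /sapp2 /sder_ev /= !dcaseE /=.
have [dE0 dE1] : (forall (p : bool) (d : subvs_of (sder S p)) k x y,
    (vsval d (k *: x + y)).1 = k *: (vsval d x).1 + (vsval d y).1) /\
  (forall (p : bool) (d : subvs_of (sder S p)) k x y,
    (vsval d (k *: x + y)).2 = k *: (vsval d x).2 + (vsval d y).2).
  by split=> p e k x y; rewrite linearP.
congr (_ + _, _ + _); rewrite tliftE //.
all: split=> u k x y /=; rewrite ?(p1, p2, dE0, dE1) //.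
all: by rewrite add_lfunE scale_lfunE.
Qed.

Lemma sapp2_ev_shom (S : salg F) i j (d : stot (sDer S)) (a : stot S) :
  d \in shom (sDer S) i -> a \in shom S j ->
  sapp2 (sder_ev S) d a = (if i then vsval d.2 else vsval d.1) a.
Proof.
rewrite !mem_shom sapp2_ev; case: d a => d0 d1 [a0 a1].
have ze (p : bool) : vsval (0 : subvs_of (sder S p)) = 0 by exact: linear0.
have z (f : 'End(stot S)) : f (0, 0) = 0 by exact: linear0.
case: i => /= /eqP -> aj.
  rewrite ze !zero_lfunE !add0r.
  have := sder_shom (subvsP d1) (a := (a0, a1)) (j := j); rewrite !mem_shom.
  move: (vsval d1) => d /=; move/(_ aj).
  by case: j aj => /eqP -> /eqP dE; rewrite [RHS]surjective_pairing dE z.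
rewrite ze !zero_lfunE !addr0.
have := sder_shom (subvsP d0) (a := (a0, a1)) (j := j); rewrite !mem_shom.
move: (vsval d0) => d /=; move/(_ aj).
by case: j aj => /eqP -> /eqP dE; rewrite [RHS]surjective_pairing dE z.
Qed.

Lemma sapp2_sder_ev (L S : salg F) (Phi : smor L (sDer S)) i j l a :
  l \in shom L i -> a \in shom S j ->
  sapp2 (scomp (sder_ev S) (stmap Phi (sid S))) l a = smor_tot Phi i l a.
Proof.
move=> li aj; rewrite sapp2_comp /= !id_lfunE -surjective_pairing.
rewrite (sapp2_ev_shom (i := i) _ aj); first by case: i {li}.
move: li; rewrite !mem_shom; case: l => l0 l1 /=.
by case: i => /eqP ->; rewrite linear0.
Qed.

Lemma dcase_l (U V W : vectType F) (f : 'Hom(U, W)) (g : 'Hom(V, W)) x :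
  dcase f g (x, 0) = f x.
Proof. by rewrite dcaseE linear0 addr0. Qed.

Lemma dcase_r (U V W : vectType F) (f : 'Hom(U, W)) (g : 'Hom(V, W)) y :
  dcase f g (0, y) = g y.
Proof. by rewrite dcaseE linear0 add0r. Qed.

Lemma dmap_l (U V U' V' : vectType F) (f : 'Hom(U, U')) (g : 'Hom(V, V')) x :
  dmap f g (x, 0) = (f x, 0).
Proof. by rewrite dmapE linear0. Qed.

Lemma dmap_r (U V U' V' : vectType F) (f : 'Hom(U, U')) (g : 'Hom(V, V')) y :
  dmap f g (0, y) = (0, g y).
Proof. by rewrite dmapE linear0. Qed.

Lemma salg_homP (L S : salg F) (Phi : smor L (sDer S)) :
  (forall i j l m, l \in shom L i -> m \in shom L j ->
     smor_tot Phi (i (+) j) (smul l m) =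
     sbracket i j (smor_tot Phi i l) (smor_tot Phi j m)) ->
  salg_hom Phi.
Proof.
move=> hom; rewrite /salg_hom /scomp.
have ev (x : sev L) : ((x, 0) : stot L) \in shom L false by rewrite mem_shom.
have od (x : sod L) : ((0, x) : stot L) \in shom L true by rewrite mem_shom.
congr (_, _); apply: prod_tens_ext => u v; apply: val_inj.
all: rewrite !comp_lfunE /=.
- rewrite dmap_l dcase_l tmapE (sder_mulE (p := false) (q := false)).
  have := hom _ _ _ _ (ev u) (ev v).
  by rewrite /smor_tot /smul /= tpure0l => ->.
- rewrite dmap_r dcase_r tmapE (sder_mulE (p := true) (q := true)).
  have := hom _ _ _ _ (od u) (od v).
  by rewrite /smor_tot /smul /= tpure0l => ->.
- rewrite dmap_l dcase_l tmapE (sder_mulE (p := false) (q := true)).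
  have := hom _ _ _ _ (ev u) (od v).
  by rewrite /smor_tot /smul /= tpure0l => ->.
- rewrite dmap_r dcase_r tmapE (sder_mulE (p := true) (q := false)).
  have := hom _ _ _ _ (od u) (ev v).
  by rewrite /smor_tot /smul /= tpure0l => ->.
Qed.
End Super.

(** * Transport of identities along an isomorphism in Ver_3 *)

Section Main.
Variables (F : fieldType) (char3 : 3%N \in [pchar F]).
Local Notation T := (T01 char3).
Local Notation JT := (JT char3).
Local Notation KT := (KT char3).
Local Notation piT := (piT char3).
Local Notation J3T := (J3T char3).
Local Notation elt := (@elt F char3 _).
Local Notation compat := (@compat F char3).

(** F(X) is a sum of copies of 1 and V_1, one for each homogeneous basis vector. This lets maps out
    of F(X) be tested on elements. *)
Lemma Ver_frame (X : svec F) :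
  exists (I : finType) (par : I -> bool) (b : I -> stot X)
    (p : I -> 'Hom(Ver char3 X, T)),
  [/\ forall k, b k \in shom X (par k), forall k, c3_mor (p k) &
      \1%VF = \sum_k (elt (b k) \o p k)%VF].
Proof.
pose I : finType := ('I_(\dim {:sev X}) + 'I_(\dim {:sod X}))%type.
pose b (k : I) : stot X := match k with
  | inl i => ((vbasis {:sev X})`_i, 0) | inr j => (0, (vbasis {:sod X})`_j) end.
pose z (V : vectType F) (_ : V) : F := 0.
pose p (k : I) := match k with
  | inl i => Ver_proj char3 (coord (vbasis {:sev X}) i) (@z (sod X))
  | inr j => Ver_proj char3 (@z (sev X)) (coord (vbasis {:sod X}) j) end.
have zl (V : vectType F) : linear (@z V : V -> F^o).
  by move=> k x y /=; rewrite scaler0 addr0.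
exists I, (fun k => if k is inr _ then true else false), b, p; split.
- by case=> k; rewrite mem_shom.
- by case=> k; apply: c3_mor_Ver_proj => //; apply: coord_linear.
- apply/lfunP => -[x m]; rewrite id_lfunE sum_lfunE big_sumType /=.
  have pl (I' : finType) (v : I' -> sev X) :
      \sum_k ((v k, 0) : Ver char3 X) = (\sum_k v k, 0).
    by elim/big_rec2: _ => //= k u w _ ->; congr (_, _); rewrite /= addr0.
  have pr (I' : finType) (v : I' -> tens (sod X) 'rV[F]_2) :
      \sum_k ((0, v k) : Ver char3 X) = (0, \sum_k v k).
    by elim/big_rec2: _ => //= k u w _ ->; congr (_, _); rewrite /= addr0.
  have e1 : \sum_(i < \dim {:sev X}) (elt (b (inl i)) \o p (inl i))%VF (x, m)
      = (x, 0).
    rewrite {2}(coord_vbasis (memvf x)) -pl; apply: eq_bigr => i _.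
    by rewrite comp_lfunE eltE Ver_projE ?tpure0l //; apply: coord_linear.
  have e2 : \sum_(j < \dim {:sod X}) (elt (b (inr j)) \o p (inr j))%VF (x, m)
      = (0, m).
    pose c j := coord (vbasis {:sod X}) j.
    pose r j : 'Hom('rV[F]_2, tens (sod X) 'rV[F]_2) :=
      linfun (tpure (vbasis {:sod X})`_j).
    have rE j u : r j u = tpure (vbasis {:sod X})`_j u.
      by apply: linfunE; case: (tpure_bilin (sod X) 'rV[F]_2).
    have : \1%VF = \sum_(j < \dim {:sod X}) (r j \o vcontract (c j))%VF.
      apply: tens_ext => y u; rewrite id_lfunE sum_lfunE.
      rewrite {1}(coord_vbasis (memvf y)) tpure_suml; apply: eq_bigr => j _.
      rewrite comp_lfunE vcontractE ?rE ?tpureZl ?tpureZr //.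
      exact: coord_linear.
    move/lfunP/(_ m); rewrite id_lfunE sum_lfunE => {2}->.
    rewrite -pr; apply: eq_bigr => j _; rewrite !comp_lfunE eltE Ver_projE //.
      by rewrite scaler0 rE.
  apply: esym; apply: etrans (congr2 +%R e1 e2) _.
  by congr (_, _); rewrite /= ?addr0 ?add0r.
Qed.

(** From right to left, both identities are resolved by [Ver_frame], which writes the difference as
    a finite sum of negligible maps precomposed with morphisms. *)
Lemma compat_ver3P (X Y Z : svec F) (A B C : C3rep F) (w : smor (stens X Y) Z)
    (f : 'Hom(Ver char3 X, A)) (g : 'Hom(Ver char3 Y, B))
    (h : 'Hom(Ver char3 Z, C)) (m : 'Hom(tens A B, C)) :
  @ver3_eq F (c3_tens (Ver char3 X) (Ver char3 Y)) C
    (h \o (Ver_map char3 w \o Ver_J char3 X Y))%VF (m \o tmap f g)%VF <->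
  (forall i j x y, x \in shom X i -> y \in shom Y j ->
    compat i j m (f \o elt x)%VF (g \o elt y)%VF
      (h \o elt (sapp2 w x y))%VF).
Proof.
pose D := (h \o (Ver_map char3 w \o Ver_J char3 X Y))%VF - (m \o tmap f g)%VF.
have DE i j x y : x \in shom X i -> y \in shom Y j ->
    (D \o tmap (elt x) (elt y))%VF =
    ((h \o elt (sapp2 w x y)) \o JT i j)%VF
      - (m \o tmap (f \o elt x) (g \o elt y))%VF.
  move=> xi yj; rewrite /D comp_lfunDl comp_lfunNl -!comp_lfunA.
  by rewrite [X in (h \o X)%VF]comp_lfunA (Ver_map_elt char3 w xi yj) tmap_comp.
split=> [e i j x y xi yj|e].
  rewrite /compat /ver3_eq -DE //.
  apply: (@negligible_compr _ _ (c3_tens (Ver char3 X) (Ver char3 Y))) => //.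
  by apply: c3_mor_tmap; apply: c3_mor_elt.
have [I [pI [bI [qI [bIP qIP idX]]]]] := Ver_frame X.
have [J [pJ [bJ [qJ [bJP qJP idY]]]]] := Ver_frame Y.
rewrite /ver3_eq -/D.
have -> : D = \sum_k \sum_l
    ((D \o tmap (elt (bI k)) (elt (bJ l))) \o tmap (qI k) (qJ l))%VF.
  apply: tens_ext => x y; rewrite sum_lfunE.
  have /lfunP/(_ x) := idX; have /lfunP/(_ y) := idY.
  rewrite !id_lfunE !sum_lfunE => {1}-> {1}->.
  rewrite tpure_suml linear_sum; apply: eq_bigr => k _.
  rewrite tpure_sumr linear_sum sum_lfunE; apply: eq_bigr => l _.
  by rewrite !comp_lfunE !tmapE.
elim/big_ind: _ => [|u v u0 v0|k _]; [exact: negligible0|exact: negligibleD|].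
elim/big_ind: _ => [|u v u0 v0|l _]; [exact: negligible0|exact: negligibleD|].
apply: (@negligible_compr _ _ (c3_tens T T)); first exact: c3_mor_tmap.
by rewrite (DE _ _ _ _ (bIP k) (bJP l)); apply: e.
Qed.

Lemma elt_sproj (X : svec F) i (s : stot X) :
  elt (sproj X i s) = (elt s \o piT i)%VF.
Proof.
rewrite -(elt_pi _ (sproj_shom i s)); apply/lfunP => t.
rewrite !comp_lfunE sprojE piTE !eltE /piT_fun.
case: i; first by rewrite /= scaler0 scale0r.
have -> : (mkT char3 (t0 t) 0 0).2 = 0.
  by apply/rowP => j; rewrite !mxE if_same.
by rewrite !tpure0r.
Qed.

Section Iso.
Variables (S : svec F) (A : C3rep F).
Variables (phi : 'Hom(Ver char3 S, A)) (g : 'Hom(A, Ver char3 S)).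
Hypotheses (phim : c3_mor phi) (gm : c3_mor g).
Hypotheses (gphi : @ver3_eq F (Ver char3 S) (Ver char3 S) (g \o phi) \1).
Hypotheses (phig : @ver3_eq F A A (phi \o g) \1).

Lemma iso_elt_inj (s s' : stot S) :
  ver3_eq (phi \o elt s)%VF (phi \o elt s')%VF -> s = s'.
Proof.
move=> e; have /(negligible_compl gm) := e.
rewrite -comp_lfunNr -comp_lfunDr comp_lfunA.
have -> : elt s - elt s' = elt (s - s').
  by have := elt_linear char3 (-1) s' s; rewrite !scaleN1r ![- _ + _]addrC => ->.
have im := c3_mor_elt char3 (s - s').
have := negligible_compr im (ver3_eq_sym gphi).
rewrite comp_lfunDl comp_lfun1l comp_lfunNl => e1 e2.
have := negligibleD e1 e2; rewrite subrK => /elt_eq0 /eqP.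
by rewrite subr_eq0 => /eqP.
Qed.

(** Solves [(phi \o elt s) \o JT i j = f] for [s] in Ver_3 by inverting each factor: [JT] by [KT],
    [phi] by [g], [elt] by [rho]. The projection [sproj] makes the solution homogeneous. *)
Definition lift_bilin i j (f : 'Hom(tens T T, A)) : stot S :=
  sproj S (i (+) j) (rho (g \o (f \o KT i j))%VF).

Lemma lift_bilin_linear i j : linear (lift_bilin i j).
Proof.
move=> k f f'; rewrite /lift_bilin comp_lfunDl -comp_lfunZl comp_lfunDr.
by rewrite -comp_lfunZr rho_linear linearP.
Qed.

Lemma lift_bilinP i j (f : 'Hom(tens T T, A)) :
  @c3_mor F (c3_tens T T) A f ->
  (f \o tmap (piT i) (piT j))%VF = f ->
  @ver3_eq F (c3_tens T T) A ((phi \o elt (lift_bilin i j f)) \o JT i j)%VF f.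
Proof.
move=> fm fpi; rewrite /lift_bilin elt_sproj.
set h := (g \o (f \o KT i j))%VF.
have hm : c3_mor h.
  apply: c3_mor_comp => //; apply: (@c3_mor_comp _ _ (c3_tens T T)) => //.
  exact: c3_mor_KT.
have hpi : (h \o piT (i (+) j))%VF = h by rewrite /h -!comp_lfunA KT_pi.
have Jm := c3_mor_JT char3 i j.
apply: (@ver3_eq_trans _ (c3_tens T T) _ ((phi \o h) \o JT i j)%VF).
  apply: (@ver3_eq_compr _ (c3_tens T T)) => //.
  apply: ver3_eq_compl => //; rewrite -{2}hpi.
  apply: ver3_eq_compr; first exact: c3_mor_piT.
  by apply: ver3_eq_sym; apply: ver3_eq_elt_rho.
have -> : ((phi \o h) \o JT i j)%VF = ((phi \o g) \o (f \o (KT i j \o JT i j)))%VF.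
  by rewrite /h -!comp_lfunA.
apply: (@ver3_eq_trans _ (c3_tens T T) _ (\1 \o (f \o (KT i j \o JT i j)))%VF).
  apply: (@ver3_eq_compr _ (c3_tens T T)) => //.
  apply: (@c3_mor_comp _ _ (c3_tens T T)) => //.
  by apply: (@c3_mor_comp _ (c3_tens T T) T); [apply: c3_mor_KT|].
rewrite comp_lfun1l -{2}fpi.
by apply: (@ver3_eq_compl _ _ (c3_tens T T)) => //; apply: KJT.
Qed.

Lemma iso_elt_J_inj i j (s s' : stot S) (f : 'Hom(tens T T, A)) :
  s \in shom S (i (+) j) -> s' \in shom S (i (+) j) ->
  @ver3_eq F (c3_tens T T) A ((phi \o elt s) \o JT i j)%VF f ->
  @ver3_eq F (c3_tens T T) A ((phi \o elt s') \o JT i j)%VF f -> s = s'.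
Proof.
move=> si s'i e /ver3_eq_sym e'; apply: iso_elt_inj.
have := ver3_eq_trans e e'.
move/(@ver3_eq_compr F T (c3_tens T T) A _ _ _ (c3_mor_KT char3 i j)).
by rewrite -!comp_lfunA JKT !elt_pi.
Qed.

(** The passage from ordinary to super identities: [M1 = M2 + M3] holds strictly in Rep C_3, and [c]
    receives the sign produced by [compat_perm]. *)
Lemma iso_elt_J3 i j k c (s1 s2 s3 : stot S)
    (M1 M2 M3 : 'Hom(tens T (tens T T), A)) :
  let p := i (+) j (+) k in
  s1 \in shom S p -> s2 \in shom S p -> s3 \in shom S p ->
  @ver3_eq F (c3_tens T (c3_tens T T)) A ((phi \o elt s1) \o J3T i j k)%VF M1 ->
  @ver3_eq F (c3_tens T (c3_tens T T)) A ((phi \o elt s2) \o J3T i j k)%VF M2 ->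
  @ver3_eq F (c3_tens T (c3_tens T T)) A
    (c *: (phi \o elt s3)%VF \o J3T i j k)%VF M3 ->
  M1 = M2 + M3 -> s1 = s2 + c *: s3.
Proof.
move=> p h1 h2 h3 e1 e2 e3 M; apply: iso_elt_inj.
have E : elt (s2 + c *: s3) = elt s2 + c *: elt s3.
  by rewrite addrC elt_linear addrC.
have := ver3_eqD e2 e3; rewrite -M => /ver3_eq_sym/(ver3_eq_trans e1).
rewrite -comp_lfunDl comp_lfunZr -comp_lfunDr -E.
move/J3T_epi; rewrite -!comp_lfunA !elt_pi //.
by rewrite memvD ?memvZ.
Qed.
End Iso.

Lemma smulDr (S : salg F) (a b b' : stot S) :
  smul a (b + b') = smul a b + smul a b'.
Proof.
by have [sr _] := smul_bilin S; have := sr a 1 b b'; rewrite !scale1r.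
Qed.

Lemma smul_shom (S : salg F) i j (a b : stot S) :
  a \in shom S i -> b \in shom S j -> smul a b \in shom S (i (+) j).
Proof. exact: sapp2_shom. Qed.

Lemma induced_by_actionP (A : C3alg F) (S L : salg F)
    (phi : 'Hom(Ver char3 S, A)) (psi : 'Hom(Ver char3 L, Der A))
    (Phi : smor L (sDer S)) :
  induced_by_action phi psi Phi <->
  (forall i j l a, l \in shom L i -> a \in shom S j ->
    compat i j (der_ev A) (psi \o elt l)%VF (phi \o elt a)%VF
      (phi \o elt (smor_tot Phi i l a))%VF).
Proof.
split=> [/compat_ver3P e i j l a li aj|e].
  by have := e i j l a li aj; rewrite (sapp2_sder_ev Phi li aj).
apply/compat_ver3P => i j l a li aj.
by rewrite (sapp2_sder_ev Phi li aj); apply: e.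
Qed.

(** * The operators on the semisimplification induced by derivations *)

Section Semisimple.
Variables (A : C3alg F) (S : salg F) (phi : 'Hom(Ver char3 S, A)).
Variable g : 'Hom(A, Ver char3 S).
Hypotheses (phim : c3_mor phi) (gm : c3_mor g).
Hypotheses (gphi : @ver3_eq F (Ver char3 S) (Ver char3 S) (g \o phi) \1).
Hypotheses (phig : @ver3_eq F A A (phi \o g) \1).
Hypothesis phi_mul :
  @ver3_eq F (c3_tens (Ver char3 S) (Ver char3 S)) A
    (phi \o (Ver_map char3 (sa_mul S) \o Ver_J char3 S S))%VF
    (c3a_mul A \o tmap phi phi)%VF.
Variables (L : salg F) (psi : 'Hom(Ver char3 L, Der A)).
Hypothesis psim : c3_mor psi.
Hypothesis psi_mul :
  @ver3_eq F (c3_tens (Ver char3 L) (Ver char3 L)) (Der A)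
    (psi \o (Ver_map char3 (sa_mul L) \o Ver_J char3 L L))%VF
    (c3a_mul (Der A) \o tmap psi psi)%VF.

Let phi_elt (s : stot S) : c3_mor (phi \o elt s)%VF.
Proof. by apply: c3_mor_comp => //; apply: c3_mor_elt. Qed.

Let psi_elt (l : stot L) : c3_mor (psi \o elt l)%VF.
Proof. by apply: c3_mor_comp => //; apply: c3_mor_elt. Qed.

Let compat_phi i j a b : a \in shom S i -> b \in shom S j ->
  compat i j (c3a_mul A) (phi \o elt a)%VF (phi \o elt b)%VF
    (phi \o elt (smul a b))%VF.
Proof. by move: phi_mul => /compat_ver3P e ai bj; apply: e. Qed.

Let compat_psi i j l m : l \in shom L i -> m \in shom L j ->
  compat i j (c3a_mul (Der A)) (psi \o elt l)%VF (psi \o elt m)%VF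
    (psi \o elt (smul l m))%VF.
Proof. by move: psi_mul => /compat_ver3P e ai bj; apply: e. Qed.

(** Specifies the operator by its effect in Ver_3. The super Leibniz rule and the bracket formula
    are derived from this relation alone; [super_end_act] later provides an operator that satisfies
    it. *)
Definition compat_act i (l : stot L) (d : 'End(stot S)) : Prop :=
  forall j a, a \in shom S j -> d a \in shom S (i (+) j) /\
    compat i j (der_ev A) (psi \o elt l)%VF (phi \o elt a)%VF
      (phi \o elt (d a))%VF.

Lemma compat_act_sder i l d : compat_act i l d -> d \in sder S i.
Proof.
move=> dP; apply/sderP; split=> [j|j a b aj].
  apply/subvP => _ /memv_imgP [x xj ->].
  by have [] := dP _ _ xj; rewrite addbC.
rewrite (sproj_sum b); move: (sproj_shom false b) (sproj_shom true b).
move: (sproj S false b) (sproj S true b) => b0 b1.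
suff main k c : c \in shom S k ->
    d (smul a c) = smul (d a) c + (-1) ^+ (i && j) *: smul a (d c).
  move=> /main e0 /main e1; rewrite smulDr !linearD /= e0 e1.
  by rewrite !smulDr scalerDr addrACA.
move=> ck; have acjk := smul_shom aj ck.
have [dac cac] := dP _ _ acjk; have [da ca] := dP _ _ aj.
have [dc cc] := dP _ _ ck.
apply: (@iso_elt_J3 _ _ _ _ gm gphi i j k).
- by rewrite -addbA.
- exact: smul_shom.
- by rewrite (addbC i) -addbA; apply: smul_shom.
- exact: (compat_right (c3_mor_der_ev A) (psi_elt l) (phi_elt _) cac
    (compat_phi aj ck)).
- exact: (compat_left (c3a_mul_mor A) (c3_mor_der_ev A) (psi_elt l) (phi_elt a)
    (phi_elt c) (phi_elt _) (compat_phi da ck) ca).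
- exact: (compat_perm (c3a_mul_mor A) (phi_elt a) (phi_elt _) (phi_elt _)
    (compat_phi aj dc) cc).
(* What is left is the ordinary Leibniz rule of the derivation [psi (elt l x)] of A. *)
apply: tens_ext3 => x y z; rewrite add_lfunE !comp_lfunE !(tassocE, tperm12E).
rewrite !tmapE !comp_lfunE !tmapE !der_evE.
rewrite !comp_lfunE; exact: (elimT (derP _) (subvsP _)).
Qed.

Lemma compat_act_bracket i j l m d e f :
  l \in shom L i -> m \in shom L j ->
  compat_act i l d -> compat_act j m e -> compat_act (i (+) j) (smul l m) f ->
  f = sbracket i j d e.
Proof.
move=> li mj dP eP fP; apply/lfunP => a.
rewrite (sproj_sum a); move: (sproj_shom false a) (sproj_shom true a).
move: (sproj S false a) (sproj S true a) => a0 a1.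
suff main k c : c \in shom S k -> f c = sbracket i j d e c.
  by move=> /main e0 /main e1; rewrite !linearD /= e0 e1.
move=> ck; have [fc cf] := fP _ _ ck.
have [dc cd] := dP _ _ ck; have [ec ce] := eP _ _ ck.
have [dec cde] := dP _ _ ec; have [edc ced] := eP _ _ dc.
rewrite /sbracket add_lfunE opp_lfunE scale_lfunE !comp_lfunE.
(* Rearranged as d(e c) = f c + (-1)^(ij) e(d c), the bracket formula has the shape of the Leibniz
   rule and the same three bracketings. *)
apply/eqP; rewrite -subr_eq opprK eq_sym; apply/eqP.
apply: (@iso_elt_J3 _ _ _ _ gm gphi i j k).
- by rewrite -addbA.
- by [].
- by rewrite (addbC i) -addbA.
- exact: (compat_right (c3_mor_der_ev A) (psi_elt l) (phi_elt _) cde ce).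
- exact: (compat_left (c3_mor_der_ev A) (c3a_mul_mor (Der A)) (psi_elt l)
    (psi_elt m) (phi_elt c) (phi_elt _) cf (compat_psi li mj)).
- exact: (compat_perm (c3_mor_der_ev A) (psi_elt m) (phi_elt _) (phi_elt _)
    ced cd).
apply: tens_ext3 => x y z; rewrite add_lfunE !comp_lfunE !(tassocE, tperm12E).
rewrite !tmapE !comp_lfunE !tmapE !der_evE der_mulE.
by rewrite add_lfunE opp_lfunE !comp_lfunE subrK.
Qed.

Definition act_hom (l : stot L) (a : stot S) : 'Hom(tens T T, A) :=
  (der_ev A \o tmap (psi \o elt l) (phi \o elt a))%VF.

(** The inverse of J that is used depends on the parity of [a], so [a] is first split into
    homogeneous parts; the result is linear on all of S. *)
Definition super_act i (l : stot L) (a : stot S) : stot S :=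
  \sum_(j : bool) lift_bilin g i j (act_hom l (sproj S j a)).

Definition super_end i (l : stot L) : 'End(stot S) := linfun (super_act i l).

Lemma super_act_bilin i : bilin (super_act i).
Proof.
split=> [l|a] k x y; rewrite /super_act scaler_sumr -big_split;
  apply: eq_bigr => j _ /=; rewrite -lift_bilin_linear; congr lift_bilin.
  by rewrite /act_hom linearP elt_linear comp_lfunDr -comp_lfunZr tmap_linear_r
    comp_lfunDr -comp_lfunZr.
by rewrite /act_hom elt_linear comp_lfunDr -comp_lfunZr tmap_linear_l
    comp_lfunDr -comp_lfunZr.
Qed.

Lemma super_endE i l a : super_end i l a = super_act i l a.
Proof. by apply: linfunE; case: (super_act_bilin i). Qed.

Lemma super_end_linear i : linear (super_end i).
Proof.
move=> k l l'; apply/lfunP => a; rewrite add_lfunE scale_lfunE !super_endE.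
by have [_ ->] := super_act_bilin i.
Qed.

Lemma super_end_act i l : l \in shom L i -> compat_act i l (super_end i l).
Proof.
move=> li j a aj.
have -> : super_end i l a = lift_bilin g i j (act_hom l a).
  rewrite super_endE /super_act (bigD1 j) //= sproj_id // big1 ?addr0 // => k kj.
  have -> : sproj S k a = 0.
    by apply/eqP; rewrite (_ : k = ~~ j) ?sproj_eq0 //;
      case: k j kj {aj} => -[].
  rewrite /act_hom (linear_fun0 (@elt_linear F char3 S)) comp_lfun0r.
  rewrite (linear_fun0 (tmap_linear_r (psi \o elt l)%VF)) comp_lfun0r.
  exact: linear_fun0 (lift_bilin_linear g i k).
split; first exact: sproj_shom.
apply: (lift_bilinP phim gm phig).
  apply: (@c3_mor_comp _ _ (c3_tens (Der A) A)); first exact: c3_mor_der_ev.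
  exact: c3_mor_tmap.
by rewrite /act_hom -comp_lfunA tmap_comp -!comp_lfunA !elt_pi.
Qed.
End Semisimple.
End Main.

(** * Existence and uniqueness of the induced homomorphism *)

Theorem proposition4p2 (F : fieldType) (char3 : 3%N \in [pchar F])
    (A : C3alg F)
    (S : salg F) (phi : 'Hom(Ver char3 S, A))
    (hS : semisimplification phi)
    (L : salg F) (psi : 'Hom(Ver char3 L, Der A))
    (hL : semisimplification psi) :
  exists! Phi : smor L (sDer S), salg_hom Phi /\ induced_by_action phi psi Phi.
Proof.
have [[phim [g [gm gphi phig]]] phi_mul] := hS.
have [[psim _] psi_mul] := hL.
pose E i := super_end phi g psi i.
have EP i l : l \in shom L i -> compat_act phi psi i l (E i l).
  exact: super_end_act.
have Es i l : l \in shom L i -> E i l \in sder S i.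
  by move=> li; apply: (compat_act_sder phim gm gphi phi_mul psim (EP _ _ li)).
have ev (x : sev L) : ((x, 0) : stot L) \in shom L false by rewrite mem_shom.
have od (x : sod L) : ((0, x) : stot L) \in shom L true by rewrite mem_shom.
pose Phi : smor L (sDer S) :=
  (linfun (fun x : sev L => vsproj (sder S false) (E false (x, 0))),
   linfun (fun x : sod L => vsproj (sder S true) (E true (0, x)))).
have lin0 : linear (fun x : sev L => vsproj (sder S false) (E false (x, 0))).
  move=> k x y; rewrite -linearP -super_end_linear; congr (vsproj _ (E _ _)).
  by congr (_, _); rewrite /= scaler0 addr0.
have lin1 : linear (fun x : sod L => vsproj (sder S true) (E true (0, x))).
  move=> k x y; rewrite -linearP -super_end_linear; congr (vsproj _ (E _ _)).
  by congr (_, _); rewrite /= scaler0 addr0.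
have PhiE i l : l \in shom L i -> smor_tot Phi i l = E i l.
  rewrite mem_shom; case: l => l0 l1; case: i => /= /eqP ->.
    by rewrite /smor_tot /Phi /= linfunE // vsprojK ?Es.
  by rewrite /smor_tot /Phi /= linfunE // vsprojK ?Es.
have Phiind : induced_by_action phi psi Phi.
  apply/induced_by_actionP => i j l a li aj; rewrite PhiE //.
  by have [] := EP i l li j a aj.
exists Phi; split.
  split=> //; apply: salg_homP => i j l m li mj.
  rewrite !PhiE //; last exact: smul_shom.
  have lm := smul_shom li mj.
  by apply: (compat_act_bracket phim gm gphi psim psi_mul li mj); apply: EP.
(* On homogeneous [l] and [a], the values under [Phi] and [Psi] both represent the action of [l] on
   [a] after composition with J. Cancelling J by its section [KT], then [phi] and [elt], identifies
   them. *)
move=> Psi [_ /induced_by_actionP Psiind].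
have {}Psiind i l : l \in shom L i -> smor_tot Phi i l = smor_tot Psi i l.
  move=> li; apply/lfunP => a; rewrite (sproj_sum a) !linearD /=.
  suff main j c : c \in shom S j -> smor_tot Phi i l c = smor_tot Psi i l c.
    by congr (_ + _); [exact: (main _ _ (sproj_shom false a))
                       | exact: (main _ _ (sproj_shom true a))].
  move=> cj; move/induced_by_actionP: Phiind => /(_ i j l c li cj) e1.
  apply: (iso_elt_J_inj gm gphi (sder_shom (smor_tot_sder Phi i l) cj)
    (sder_shom (smor_tot_sder Psi i l) cj) e1).
  exact: Psiind.
rewrite [LHS]surjective_pairing [RHS]surjective_pairing.
congr (_, _); apply/lfunP => x; apply: val_inj.
  exact: (Psiind false _ (ev x)).
exact: (Psiind true _ (od x)).
Qed.
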